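(* Let $p>1$, let $N\ge2$ be an integer, and set $\Lambda_p:=\left(\frac{N-1}{p}\right)^p$. There exists a positive constant $C(N,p)$, depending only on $N$ and $p$, such that for all $u\in C_c^\infty(\mathbb{R}^N_+)$ $$\int_{\mathbb{R}^+}\int_{\mathbb{R}^{N-1}}\frac{|\nabla u|^p}{y^{N-p}}\,{\rm d}x\,{\rm d}y-\Lambda_p\int_{\mathbb{R}^+}\int_{\mathbb{R}^{N-1}}\frac{|u|^p}{y^N}\,{\rm d}x\,{\rm d}y\ \ge\ \left(\frac{N-1}{p}\right)^{p-2}C(N,p)\int_{\mathbb{R}^+}\int_{\mathbb{R}^{N-1}}\frac{|u|^p}{y^{N-1}\sqrt{y^2+x_1^2}}\,{\rm d}x\,{\rm d}y,$$ where $C(N,p)$ satisfies, with $p'=\frac{p}{p-1}$, $$C(N,p)\ge\frac{1}{4p'}\quad\text{if }1<p\le \tfrac43,$$ $$C(N,p)\ge\left(2(8-3p)+2\sqrt{p'(8-3p)}\right)^{-1}\quad\text{if }\tfrac43<p\le 2,$$ $$C(N,p)=\frac{1}{\sqrt2}\,\frac{1}{\sqrt2\,p+2\sqrt p}\quad\text{if }2<p\le 2(N-1)^2,$$ $$C(N,p)=\left(\frac{p}{N-1}+2p+2(N-1)\right)^{-1}\quad\text{if }p>2(N-1)^2.$$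
   Context: $\mathbb{R}^N_+=\{(x,y)\in\mathbb{R}^{N-1}\times\mathbb{R}^+\}$ is the open upper half-space, with $x=(x_1,\dots,x_{N-1})\in\mathbb{R}^{N-1}$ and $y>0$. $\nabla u$ denotes the Euclidean gradient of $u$ with respect to all variables $(x,y)$ and $|\cdot|$ the Euclidean norm. *)

(* Defs.v *)
From HB Require Import structures.
From mathcomp Require Import all_boot all_order all_algebra.
From mathcomp Require Import all_classical all_reals all_analysis.
Set Implicit Arguments.
Unset Strict Implicit.
Unset Printing Implicit Defensive.
Import Order.TTheory GRing.Theory Num.Theory.
Import numFieldNormedType.Exports.
Local Open Scope classical_set_scope.
Local Open Scope ring_scope.

Definition partial (R : realType) n (i : 'I_n) (u : 'rV[R]_n -> R) :
  'rV[R]_n -> R := fun z => 'D_(delta_mx 0 i) u z.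

Definition gradient (R : realType) n (u : 'rV[R]_n -> R) (z : 'rV[R]_n) :
  'rV[R]_n := \row_i partial i u z.

(* The library norm `|v| on 'rV[R]_n is the sup norm. *)
Definition enorm (R : realType) n (v : 'rV[R]_n) : R :=
  Num.sqrt (\sum_i v 0 i ^+ 2).

Fixpoint Ck (R : realType) n (k : nat) (u : 'rV[R]_n -> R) : Prop :=
  continuous u /\
  if k is k'.+1 then
    forall i, (forall z, derivable u z (delta_mx 0 i)) /\ Ck k' (partial i u)
  else True.

Definition Cinfty (R : realType) n (u : 'rV[R]_n -> R) : Prop :=
  forall k, Ck k u.

(* Elements of C_c^oo(Omega), Omega open, are identified with their extensions
   by zero to R^n. *)
Definition Cc_infty (R : realType) n (Omega : set 'rV[R]_n)
    (u : 'rV[R]_n -> R) : Prop :=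
  [/\ Cinfty u, compact (closure [set z | u z != 0])
    & closure [set z | u z != 0] `<=` Omega].

(* A point (x, y) of R^m * R is the row vector row_mx x y%:M. *)
Definition halfspace (R : realType) m : set 'rV[R]_(m + 1) :=
  [set z | 0 < rsubmx z 0 0].

(* Lebesgue integral over R^m, as an iterated one-dimensional integral: for the
   nonnegative Borel integrands considered here, this is the integral against
   the m-dimensional Lebesgue measure, by Tonelli. *)
Fixpoint integral_rV (R : realType) m : ('rV[R]_m -> \bar R) -> \bar R :=
  match m with
  | 0 => fun f => f 0
  | m'.+1 => fun f =>
      (\int[@lebesgue_measure R]_t
        integral_rV (fun v : 'rV[R]_m' => f (row_mx t%:M v)))%E
  end.

Definition integral_halfspace (R : realType) m (f : 'rV[R]_m -> R -> R) :
  \bar R :=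
  (\int[@lebesgue_measure R]_(y in `]0%R, +oo[)
    integral_rV (fun x => (f x y)%:E))%E.

Lemma pred_gt0 N : (2 <= N)%N -> (0 < N.-1)%N.
Proof. by rewrite ltn_predRL. Qed.

Definition coord1 (R : realType) N (hN : (2 <= N)%N) (x : 'rV[R]_(N.-1)) : R :=
  x 0 (Ordinal (pred_gt0 hN)).

(* Main.v *)
Require Import Defs.
From HB Require Import structures.
From mathcomp Require Import all_boot all_order all_algebra.
From mathcomp Require Import all_classical all_reals all_analysis.
From mathcomp Require Import ring lra.
Set Implicit Arguments.
Unset Strict Implicit.
Unset Printing Implicit Defensive.
Import Order.TTheory GRing.Theory Num.Theory.
Import numFieldNormedType.Exports.
Local Open Scope classical_set_scope.
Local Open Scope ring_scope.

(** Write m = N - 1, q = m / p, p' = p / (p - 1), r = sqrt (y^2 + x_1^2) and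
    s = y / r.  The proof tests the divergence theorem against one explicit
    vector field.  For a field W on the half-space, div (|u|^p W) integrates
    to 0, and Young's inequality p G B^(p-1) <= G^p + (p-1) B^p, applied with
    G = y |grad u| and B = q |u| |y^m W|^(1/(p-1)), gives pointwise
      y^(p-N) |grad u|^p >= q^(p-1) div (|u|^p W)
        + (- q^(p-1) div W - (p-1) q^p y^(-N) |y^m W|^p') |u|^p.
    The field W = y^(-m) e_y yields the Hardy inequality with the constant
    q^p.  To gain the extra term, W is perturbed by two fields that are
    homogeneous of the same degree,
      W = y^(-m) (e_y - (k s e_y + b s e_r) / m),
    where e_r is the radial unit vector of the (x_1, y)-plane.  Since
    y div (s e_y) = s (1 - s^2) and y div (s e_r) = s^2, the first one
    produces the weight s, that is |u|^p / (y^m r), and the second one repairs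
    the loss near s = 1.  With C = k / p everything reduces to one scalar
    inequality in s in [0, 1], called [key_inequality] below.

    For p <= 2 one has p' >= 2, and the second-order Taylor bound of t^p' at
    t = 1, valid on [0, 1] ([powR_le_taylor2]), reduces it to a quadratic
    inequality, solved by (k, b) = ((p-1)/4, 3(p-1)/4).
      So C = 1 / (4 p') works for all
    p <= 2, and on (4/3, 2] it is at least the announced bound because
    p' <= 8 - 3p there.

    For p > 2 one has 1 < p' < 2, and t^p' is interpolated between t and t^2
    ([powR_le_chord]).  With k + b = 1 and k = 1 / (2 + n + n z), where
    (n, z) = (sqrt (2/p), 1) when p <= 2 m^2 and (n, z) = (1/m, 2 m^2 / p)
    when p > 2 m^2, it becomes a polynomial inequality on the cube
    ([key_polynomial_le0]); these k give exactly the two announced constants.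

    The integrals are iterated one-dimensional integrals.  On uniformly
    continuous functions vanishing outside a ball they form a finite positive
    linear functional that kills partial derivatives ([rintegral_specP] and
    [rintegral_partial]), which is all that the divergence theorem requires
    here.  All functions involved vanish off the support of u, which is
    compact in the open half-space, so they belong to this class. *)

(** * Inequalities for real powers *)

Section power_inequalities.
Variable R : realType.
Implicit Types a b p r x y G B : R.

Lemma young_powR p G B : 1 < p -> 0 <= G -> 0 <= B ->
  p * G * B `^ (p - 1) <= G `^ p + (p - 1) * B `^ p.
Proof.
move=> p1 G0 B0.
have p0 : 0 < p by lra.
have pp0 : 0 < p - 1 by lra.
have pn : p != 0 by rewrite gt_eqF.
have ppn : p - 1 != 0 by rewrite gt_eqF.
have h : p^-1 + (p / (p - 1))^-1 = 1 by field; rewrite pn ppn.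
have := conjugate_powR G0 (powR_ge0 B (p - 1)) p0 (divr_gt0 p0 pp0) h.
have e : (p - 1) * (p / (p - 1)) = p by field.
rewrite -powRrM e => /(ler_wpM2l (ltW p0)); rewrite mulrA => /le_trans; apply.
by rewrite le_eqVlt; apply/orP; left; apply/eqP; field; rewrite ?pn ?ppn.
Qed.

(** Weighted arithmetic-geometric mean inequality between y and 1. *)
Lemma powR_le_affine a y : 0 <= a <= 1 -> 0 <= y ->
  y `^ a <= 1 + a * (y - 1).
Proof.
move=> /andP[a0 a1] y0.
have [->|an0] := eqVneq a 0; first by rewrite powRr0 mul0r addr0.
have [->|an1] := eqVneq a 1; first by rewrite powRr1//; lra.
have {}a0 : 0 < a by rewrite lt_neqAle eq_sym an0.
have {}a1 : 0 < 1 - a by rewrite subr_gt0 lt_neqAle an1.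
have h : a^-1^-1 + (1 - a)^-1^-1 = 1 by rewrite !invrK; lra.
have ia : 0 < a^-1 by rewrite invr_gt0.
have ib : 0 < (1 - a)^-1 by rewrite invr_gt0.
have := conjugate_powR (powR_ge0 y a) ler01 ia ib h.
rewrite mulr1 -powRrM divff// powRr1// powR1 !invrK; lra.
Qed.

(** Bernoulli's inequality, by inverting the concave case of exponent 1/a. *)
Lemma powR_ge_affine a x : 1 <= a -> 0 <= x ->
  1 + a * (x - 1) <= x `^ a.
Proof.
move=> a1 x0.
have a0 : 0 < a by lra.
have an : a != 0 by rewrite gt_eqF.
have := @powR_le_affine a^-1 (x `^ a) _ (powR_ge0 _ _).
rewrite -powRrM divff// powRr1// invr_ge0 (ltW a0) invf_le1// a1 => /(_ isT).
move=> /(ler_wpM2l (ltW a0)); rewrite mulrDr mulrA divff//; lra.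
Qed.

(** Log-convexity in the exponent: x^r is a geometric mean of x and x^2. *)
Lemma powR_le_chord r x : 1 <= r <= 2 -> 0 <= x ->
  x `^ r <= (2 - r) * x + (r - 1) * x ^+ 2.
Proof.
move=> /andP[r1 r2] x0.
rewrite -mulr_powRB1//; last by lra.
have := @powR_le_affine (r - 1) x _ x0; rewrite !subr_ge0 r1/= => h.
have /(ler_wpM2l x0) : x `^ (r - 1) <= 1 + (r - 1) * (x - 1) by apply: h; lra.
by move=> /le_trans; apply; rewrite le_eqVlt; apply/orP; left; apply/eqP; ring.
Qed.

(** The difference of both sides has derivative r (1 + (r-1) (x-1) - x^(r-1)),
    which is nonpositive by Bernoulli's inequality, and vanishes at x = 1. *)
Lemma powR_le_taylor2 r x : 2 <= r -> 0 <= x <= 1 ->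
  x `^ r <= 1 + r * (x - 1) + r * (r - 1) / 2 * (x - 1) ^+ 2.
Proof.
move=> r2 /andP[x0 x1].
have [->|xn0] := eqVneq x 0.
  by rewrite powR0; [nra|rewrite gt_eqF//; lra].
have [->|xn1] := eqVneq x 1; first by rewrite powR1; lra.
have {}x0 : 0 < x by rewrite lt_neqAle eq_sym xn0.
have {}x1 : x < 1 by rewrite lt_neqAle xn1.
pose f y := 1 + r * (y - 1) + r * (r - 1) / 2 * (y - 1) ^+ 2 - y `^ r.
pose df y := r + r * (r - 1) * (y - 1) - r * y `^ (r - 1).
have fE y : 0 < y -> is_derive y 1 f (df y).
  move=> y0; rewrite /f /df.
  have h1 : is_derive y 1 (fun y : R => y - 1) 1.
    by apply: is_derive_eq; rewrite subr0.
  have h2 : is_derive y 1 (fun y : R => (y - 1) ^+ 2) (2 * (y - 1)).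
    by apply: is_derive_eq; rewrite /GRing.scale/=; ring.
  have h3 : is_derive y 1 (fun y : R => 1 + r * (y - 1)) (0 + r * 1).
    by apply: is_deriveD.
  have h4 : is_derive y 1 (fun y : R => r * (r - 1) / 2 * (y - 1) ^+ 2)
      (r * (r - 1) / 2 * (2 * (y - 1))).
    exact: is_deriveZ.
  have -> : r + r * (r - 1) * (y - 1) - r * y `^ (r - 1) = 0 + r * 1 +
     r * (r - 1) / 2 * (2 * (y - 1)) - r * y `^ (r - 1) by field.
  exact: (is_deriveB (is_deriveD h3 h4) (is_derive1_powR r y0)).
have [c] : exists2 c, c \in `]x, 1[ & f 1 - f x = df c * (1 - x).
  apply: (@MVT R f df x 1 x1) => [y|].
    by rewrite in_itv/= => /andP[xy _]; apply/fE/(lt_trans x0).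
  apply: derivable_within_continuous => y; rewrite in_itv/= => /andP[xy _].
  by have [] := fE y (lt_le_trans x0 xy).
rewrite in_itv/= => /andP[xc c1] E.
suff : f 1 <= f x.
  by rewrite /f powR1 subrr mulr0 expr0n/= mulr0 !addr0 subrr subr_ge0.
have r0 : 0 <= r by lra.
have := @powR_ge_affine (r - 1) c; have : 0 <= c by lra.
have : 1 <= r - 1 by lra.
move=> r1 c0 /(_ r1 c0) /(ler_wpM2l r0) h.
have df0 : df c <= 0 by rewrite /df; lra.
have t0 : 0 <= 1 - x by lra.
by rewrite -subr_le0 E mulr_le0_ge0.
Qed.

End power_inequalities.

(** * The scalar inequality behind the constants *)

(** The opposite of the left-hand side has nonnegative Bernstein coefficients
    in s: the proof writes it as
    c0 s^3 + c1 s^2 (1-s) + c2 s (1-s)^2 + c3 (1-s)^3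
    and checks that each ci, a polynomial in n and z, is nonnegative.  The
    inequality is sharp at s = 1 for n = 0 and for n = 1. *)
Lemma key_polynomial_le0 (R : realFieldType) (n z s u D : R) :
  0 <= n <= 1 -> 0 <= z <= 1 -> 0 <= s <= 1 ->
  u = 1 + n * (1 + z) -> D = 1 + u ->
  D * (1 - z * n ^+ 2) * u ^+ 2 * (1 - s ^+ 2) +
  (z * n ^+ 2 * (u ^+ 2 + 2 * u * s + 1) - 2 * D * (u - s)) *
  (D - n * s - n * u * s ^+ 2) <= 0.
Proof.
move=> /andP[n0 n1] /andP[z0 z1] /andP[s0 s1] uE DE.
have [N0 Z0 t0] : [/\ 0 <= 1 - n, 0 <= 1 - z & 0 <= 1 - s].
  by rewrite !subr_ge0.
have D0 : 0 <= D by rewrite DE uE !addr_ge0 ?mulr_ge0 ?addr_ge0.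
have powle k : n ^+ k.+2 <= n.
  by rewrite exprS -[leRHS]mulr1 ler_wpM2l// exprn_ile1.
have pow0 k : 0 <= n ^+ k by rewrite exprn_ge0.
have z2 : z ^+ 2 <= z by rewrite expr2 -[leRHS]mulr1 ler_wpM2l.
have z3 : z ^+ 3 <= z by rewrite exprS -[leRHS]mulr1 ler_wpM2l// exprn_ile1.
have nzD : z * n * D <= 2 * (1 + z).
  have : n * D <= 3 + z by rewrite DE uE; nra.
  by move=> h; rewrite -mulrA; nra.
(* c1 is expanded once more in the Bernstein basis, of degree 3 in z, because it
   vanishes at n = z = 1; e2 and e3 are written so as to display the factor
   1 - n. *)
pose c0 := D ^+ 2 * (n * (2 * (1 + z) - z * n * D)) * (1 - n).
pose e0 := 2 + 6 * n - 4 * n ^+ 2 - 2 * n ^+ 3.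
pose e1 := 6 + 28 * n - 20 * n ^+ 2 - 12 * n ^+ 3 + 2 * n ^+ 4 + n ^+ 5.
pose e2 := (1 - n) * (6 + 44 * n + 20 * n ^+ 2 - 6 * n ^+ 3 - n ^+ 4)
  + 3 * n ^+ 5.
pose e3 := (1 - n) * (2 + 18 * n + 10 * n ^+ 2 - 6 * n ^+ 3 - 4 * n ^+ 4).
pose c1 := D * (e0 * (1 - z) ^+ 3 + e1 * (z * (1 - z) ^+ 2)
  + e2 * (z ^+ 2 * (1 - z)) + e3 * z ^+ 3).
pose c2 := 10 + 21 * n + 25 * n * z + 10 * n ^+ 2 + 16 * n ^+ 2 * z
  + 16 * n ^+ 2 * z ^+ 2 + n ^+ 3 - 2 * n ^+ 3 * z - 2 * n ^+ 3 * z ^+ 2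
  + 3 * n ^+ 3 * z ^+ 3 - 2 * n ^+ 4 * z ^+ 2 - 2 * n ^+ 4 * z ^+ 3
  + n ^+ 5 * z + 2 * n ^+ 5 * z ^+ 2 + n ^+ 5 * z ^+ 3.
pose c3 := D * (u ^+ 2 + 2 * u - z * n ^+ 2).
have c00 : 0 <= c0 by rewrite !mulr_ge0 ?subr_ge0.
have c10 : 0 <= c1.
  have := powle 0; have := powle 1; have := powle 2; have := pow0 4%N.
  have := pow0 5%N; have := pow0 2%N.
  move=> *; rewrite mulr_ge0// !addr_ge0// mulr_ge0 ?mulr_ge0 ?exprn_ge0//.
  - by rewrite /e0; lra.
  - by rewrite /e1; lra.
  - by rewrite addr_ge0// ?mulr_ge0//; lra.
  - by lra.
have c20 : 0 <= c2.
  have h k l : 0 <= n ^+ k * z ^+ l by rewrite mulr_ge0 ?exprn_ge0.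
  have h2 k l : n ^+ k.+2 * z ^+ l.+1 <= n * z.
    rewrite ler_pM ?exprn_ge0// exprS -[leRHS]mulr1 ler_wpM2l// exprn_ile1//.
  have := h2 1 0; have := h2 1 1; have := h2 2 1; have := h2 2 2.
  have := h 2%N 1%N; have := h 2%N 2%N; have := h 3 3; have := h 5 1%N.
  have := h 5 2%N; have := h 5 3; have := h 1%N 1%N.
  have := pow0 2%N; have := pow0 3%N.
  by rewrite /c2 => *; lra.
have c30 : 0 <= c3.
  rewrite mulr_ge0// subr_ge0.
  have : z * n ^+ 2 <= 1 by rewrite mulr_ile1 ?exprn_ile1 ?exprn_ge0.
  have : 1 <= u by rewrite uE lerDl mulr_ge0// addr_ge0.
  by move=> ? ?; have := exprn_ege1 2 _; nra.
rewrite -oppr_ge0.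
suff -> : - (D * (1 - z * n ^+ 2) * u ^+ 2 * (1 - s ^+ 2) +
  (z * n ^+ 2 * (u ^+ 2 + 2 * u * s + 1) - 2 * D * (u - s)) *
  (D - n * s - n * u * s ^+ 2)) = c0 * s ^+ 3 + c1 * (s ^+ 2 * (1 - s))
  + c2 * (s * (1 - s) ^+ 2) + c3 * (1 - s) ^+ 3.
  by rewrite !addr_ge0// mulr_ge0// ?mulr_ge0 ?exprn_ge0.
by rewrite /c0 /c1 /c2 /c3 /e0 /e1 /e2 /e3 DE uE; ring.
Qed.

Section key.
Variable R : realType.
Implicit Types p m k b s : R.

(** This is |y^m W|^2 at a point where y / r = s.  The vertical component of
    y^m W is 1 - s (k + b s) / m, and the horizontal one is, up to sign,
    b s sqrt (1 - s^2) / m. *)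
Definition field_sqnorm m k b s : R :=
  (1 - s * (k + b * s) / m) ^+ 2 + b ^+ 2 * s ^+ 2 * (1 - s ^+ 2) / m ^+ 2.

(** After division by q^(p-2) y^(-N) / p, this is the bound
    - q^(p-1) div W - (p-1) q^p y^(-N) |y^m W|^p' >=
      q^p y^(-N) + q^(p-2) (k / p) / (y^m r).
    Grouped as on the left, the terms of order m^2 and m cancel, so that the
    constants can be chosen uniformly in m. *)
Definition key_inequality p m k b : Prop := forall s, 0 <= s <= 1 ->
  m ^+ 2 * ((p - 1) / p) *
    (Num.sqrt (field_sqnorm m k b s) `^ (p / (p - 1)) - 1
     + p / (p - 1) * (s * (k + b * s)) / m)
  <= s ^+ 2 * (b - k * s).

Lemma field_sqnorm_ge0 m k b s : 0 <= s <= 1 -> 0 <= field_sqnorm m k b s.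
Proof.
move=> /andP[s0 s1]; rewrite addr_ge0 ?sqr_ge0// divr_ge0 ?sqr_ge0//.
by rewrite mulr_ge0 ?subr_ge0 ?expr_le1// mulr_ge0 ?sqr_ge0.
Qed.

(** Here W has y^m |W| <= 1, so the Taylor bound applies and its quadratic
    term is controlled by |y^m W - e_y|^2, as 1 - |y^m W| <= |y^m W - e_y|.
    The pair (1/4, 3/4) gives the largest k when p = 2, and the factor p - 1
    makes the remaining inequality independent of p. *)
Lemma key_inequality_le2 p m : 1 < p <= 2 -> 1 <= m ->
  key_inequality p m ((p - 1) / 4) (3 * (p - 1) / 4).
Proof.
move=> /andP[p1 p2] m1 s s01.
have P0 := field_sqnorm_ge0 m ((p - 1) / 4) (3 * (p - 1) / 4) s01.
move: P0; set k := (p - 1) / 4; set b := 3 * (p - 1) / 4.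
set P := field_sqnorm _ _ _ _ => P0.
set r := p / (p - 1).
have /andP[s0 s1] := s01.
have m0 : 0 < m by lra.
have mn : m != 0 by rewrite gt_eqF.
have p0 : 0 < p by lra.
have pn : p != 0 by rewrite gt_eqF.
have q0 : 0 < p - 1 by lra.
have qn : p - 1 != 0 by rewrite gt_eqF.
have r2 : 2 <= r by rewrite ler_pdivlMr//; lra.
have k0 : 0 <= k by rewrite divr_ge0// ltW.
have b0 : 0 <= b by rewrite divr_ge0// mulr_ge0// ltW.
(* G / m^2 is |y^m W - e_y|^2, and - w / m is its vertical component. *)
pose G := s ^+ 2 * (b ^+ 2 + 2 * k * b * s + k ^+ 2).
pose w := s * (k + b * s).
have PE : P = 1 - 2 * w / m + G / m ^+ 2.
  by rewrite /P /field_sqnorm /w /G; field.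
have x2 : Num.sqrt P ^+ 2 = P by rewrite sqr_sqrtr.
have hx : 1 - w / m <= Num.sqrt P.
  apply: (le_trans (ler_norm _)); rewrite -sqrtr_sqr ler_wsqrtr//.
  rewrite /P /field_sqnorm lerDl divr_ge0 ?sqr_ge0//.
  by rewrite mulr_ge0 ?subr_ge0 ?expr_le1// mulr_ge0 ?sqr_ge0.
have G0 : 0 <= G.
  rewrite mulr_ge0 ?sqr_ge0// addr_ge0 ?sqr_ge0// addr_ge0 ?sqr_ge0//.
  by rewrite mulr_ge0// mulr_ge0// mulr_ge0.
have Gw : G <= 2 * w.
  rewrite /G /w /b /k; have : 0 <= s * (1 - s) by rewrite mulr_ge0 ?subr_ge0.
  have := mulr_ge0 s0 s0; set q := p - 1 in q0 *.
  have q1 : q <= 1 by rewrite /q; lra.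
  move=> s2 ss.
  have -> : s ^+ 2 * ((3 * q / 4) ^+ 2 + 2 * (q / 4) * (3 * q / 4) * s +
    (q / 4) ^+ 2)
    = q * (q * (s * s * (10 + 6 * s) / 16)) by field.
  have -> : 2 * (s * (q / 4 + 3 * q / 4 * s)) = q * (s * (2 +
    6 * s) / 4) by field.
  rewrite ler_pM2l//.
  have t0 : 0 <= s * s * (10 + 6 * s) / 16 by rewrite divr_ge0 ?mulr_ge0//; lra.
  by apply: (le_trans (ler_piMl t0 q1)); nra.
have P1 : P <= 1.
  rewrite PE -addrA gerDl addrC subr_le0.
  rewrite expr2 invfM mulrA ler_pM2r ?invr_gt0// ler_pdivrMr//.
  by apply: (le_trans Gw); rewrite ler_peMr// (le_trans G0).
have x01 : 0 <= Num.sqrt P <= 1.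
  by rewrite sqrtr_ge0/= -sqrtr1 ler_wsqrtr.
have := powR_le_taylor2 r2 x01.
set y := _ `^ _; set x := Num.sqrt P in x2 hx x01 *.
have -> : 1 + r * (x - 1) + r * (r - 1) / 2 * (x - 1) ^+ 2 =
  1 + r / 2 * (x ^+ 2 - 1) + r * (r - 2) / 2 * (x - 1) ^+ 2 by field.
have hG : (x - 1) ^+ 2 <= G / m ^+ 2.
  have -> : (x - 1) ^+ 2 = x ^+ 2 - 2 * x + 1 by ring.
  by rewrite x2 PE; lra.
have rr0 : 0 <= r * (r - 2) / 2 by rewrite divr_ge0// mulr_ge0//; lra.
move=> /le_trans /(_ (lerD (lexx _) (ler_wpM2l rr0 hG))).
rewrite x2 PE => yle.
apply: (@le_trans _ _ (G / (2 * (p - 1)))).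
  have c0 : 0 <= m ^+ 2 * ((p - 1) / p)
    by rewrite mulr_ge0 ?sqr_ge0// divr_ge0// ltW.
  have : y - 1 + r * w / m <= r * (r - 1) / 2 * (G / m ^+ 2) by lra.
  move=> /(ler_wpM2l c0) /le_trans; apply.
  rewrite le_eqVlt; apply/orP; left; apply/eqP; rewrite /r; field.
  by rewrite ?pn ?qn ?mn.
rewrite ler_pdivrMr ?mulr_gt0// /G -[leRHS]mulrA ler_wpM2l ?sqr_ge0//.
have : 0 <= (p - 1) ^+ 2 * (1 - s) by rewrite mulr_ge0 ?sqr_ge0 ?subr_ge0.
rewrite /b /k; lra.
Qed.

(** The condition 1/m <= n makes the vertical component h of y^m W at least
    hn = 1 - n s (k + b s); this keeps only n and z in the final polynomial.
    Then y^m |W| is at most h + a / m^2 with a = A / (2 hn), where A / m^2 is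
    the square of the horizontal component. *)
Lemma key_inequality_ge2 p m n z u D : 2 <= p -> 1 <= m ->
  0 < n <= 1 -> m^-1 <= n -> 0 <= z <= 1 -> p^-1 = z * n ^+ 2 / 2 ->
  u = 1 + n * (1 + z) -> D = 1 + u ->
  key_inequality p m D^-1 (u / D).
Proof.
move=> p2 m1 /andP[n0 n1] mn z01 pE uE DE s s01.
have /andP[s0 s1] := s01; have /andP[z0 z1] := z01.
have P0 := field_sqnorm_ge0 m D^-1 (u / D) s01.
set k := D^-1 in P0 *; set b := u / D in P0 *.
set P := field_sqnorm _ _ _ _ in P0 *.
set r := p / (p - 1).
have u1 : 1 <= u by rewrite uE lerDl mulr_ge0 ?(ltW n0)// addr_ge0.
have D0 : 0 < D by lra.
have Dn : D != 0 by rewrite gt_eqF.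
have m0 : 0 < m by lra.
have mn0 : m != 0 by rewrite gt_eqF.
have p0 : 0 < p by lra.
have pn : p != 0 by rewrite gt_eqF.
have q0 : 0 < p - 1 by lra.
have qn : p - 1 != 0 by rewrite gt_eqF.
have r12 : 1 <= r <= 2 by rewrite ler_pdivlMr// ler_pdivrMr//; lra.
have /andP[r1 r2] := r12.
have r0 : 0 < r by lra.
pose w := s * (k + b * s).
pose h := 1 - w / m.
pose A := b ^+ 2 * s ^+ 2 * (1 - s ^+ 2).
pose hn := 1 - n * w.
have kb : k + b = 1 by rewrite /k /b -{1}[D^-1]mul1r -mulrDl -DE divff.
have k0 : 0 <= k by rewrite invr_ge0 ltW.
have b0 : 0 <= b by rewrite divr_ge0 ?ltW//; lra.
have ws : w <= s.
  rewrite /w -[leRHS]mulr1 ler_wpM2l// -kb lerD2l -[leRHS]mulr1 ler_wpM2l//.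
have w0 : 0 <= w by rewrite mulr_ge0// addr_ge0// mulr_ge0.
have hnh : hn <= h.
  by rewrite /hn /h lerD2l lerN2 mulrC ler_wpM2r.
have A0 : 0 <= A.
  by rewrite mulr_ge0 ?subr_ge0 ?expr_le1// mulr_ge0 ?sqr_ge0.
have hn0 : 0 <= hn.
  by rewrite subr_ge0 mulr_ile1 ?(ltW n0)// (le_trans ws).
have PE : P = h ^+ 2 + A / m ^+ 2 by [].
have x2 : Num.sqrt P ^+ 2 = P by rewrite sqr_sqrtr.
have c0 : 0 <= m ^+ 2 * ((p - 1) / p)
  by rewrite mulr_ge0 ?sqr_ge0// divr_ge0// ltW.
(* In the chord bound the terms that are linear in w cancel, which leaves a
   bound independent of m. *)
have reduce a : Num.sqrt P <= h + a / m ^+ 2 ->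
    (p - 2) / p * a + (A + w ^+ 2) / p <= s ^+ 2 * (b - k * s) ->
  m ^+ 2 * ((p - 1) / p) * (Num.sqrt P `^ r - 1 + r * w / m)
  <= s ^+ 2 * (b - k * s).
  move=> ha; apply: le_trans.
  have := powR_le_chord r12 (sqrtr_ge0 P).
  rewrite x2 PE.
  have r20 : 0 <= 2 - r by lra.
  move: ha; rewrite PE => ha.
  move=> /le_trans /(_ (lerD (ler_wpM2l r20 ha) (lexx _))) yle.
  have : Num.sqrt (h ^+ 2 + A / m ^+ 2) `^ r - 1 + r * w / m <=
    (2 - r) * (a / m ^+ 2) + (r - 1) * (A / m ^+ 2 + (w / m) ^+ 2).
    move: yle; rewrite /h; lra.
  move=> /(ler_wpM2l c0) /le_trans; apply.
  rewrite le_eqVlt; apply/orP; left; apply/eqP; rewrite /r; field.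
  by rewrite ?pn ?qn ?mn0.
(* For s = 1 the denominator hn may vanish, but so does A. *)
have [sE|sn1] := eqVneq s 1.
  have wE : w = 1 by rewrite /w sE mulr1 mul1r.
  have AE : A = 0 by rewrite /A sE; ring.
  apply: (reduce 0).
    rewrite mul0r addr0 PE AE mul0r addr0 sqrtr_sqr ger0_norm//.
    exact: le_trans hnh.
  rewrite AE wE sE mulr0 add0r add0r expr1n !mul1r mulr1.
  rewrite pE /b /k.
  have -> : u / D - D^-1 = n * (1 + z) / D by rewrite uE; field.
  rewrite ler_pdivlMr//.
  have nD : n * D <= 3 + z by rewrite DE uE; nra.
  have : z * (n * D) <= 2 * (1 + z) by nra.
  move=> /(ler_wpM2l (ltW n0)); nra.
have {}sn1 : s < 1 by rewrite lt_neqAle sn1.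
have hn1 : 0 < hn.
  rewrite /hn subr_gt0 (le_lt_trans _ sn1)// (le_trans _ ws)//.
  by rewrite -[leRHS]mul1r ler_wpM2r.
have h0 : 0 < h by exact: lt_le_trans hnh.
have hnn : hn != 0 by rewrite gt_eqF.
apply: (reduce (A / (2 * hn))).
  have B0 : 0 <= A / (2 * hn) / m ^+ 2.
    by rewrite divr_ge0 ?sqr_ge0// divr_ge0// mulr_ge0.
  have t0 := addr_ge0 (ltW h0) B0.
  rewrite -(ger0_norm t0) -sqrtr_sqr ler_wsqrtr// PE.
  set a := A / (2 * hn) / m ^+ 2 in B0 *.
  have -> : (h + a) ^+ 2 = h ^+ 2 + (h * a *+ 2 + a ^+ 2) by ring.
  rewrite lerD2l; apply: (@le_trans _ _ (h * a *+ 2)); last first.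
    by rewrite lerDl sqr_ge0.
  have -> : h * a *+ 2 = h / hn * (A / m ^+ 2).
    by rewrite /a; field; rewrite ?mn0 ?hnn.
  apply: ler_peMl; first by rewrite divr_ge0 ?sqr_ge0.
  by rewrite ler_pdivlMr// mul1r.
rewrite -(ler_pM2r hn1) -subr_le0.
have -> : ((p - 2) / p * (A / (2 * hn)) + (A + w ^+ 2) / p) * hn -
    s ^+ 2 * (b - k * s) * hn =
  (1 / 2 - p^-1) * A + ((A + w ^+ 2) * p^-1 - s ^+ 2 * (b - k * s)) * hn.
  by field; rewrite ?pn ?hnn.
rewrite pE.
have -> : (1 / 2 - z * n ^+ 2 / 2) * A +
    ((A + w ^+ 2) * (z * n ^+ 2 / 2) - s ^+ 2 * (b - k * s)) * hn =
  s ^+ 2 / (2 * D ^+ 3) *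
  (D * (1 - z * n ^+ 2) * u ^+ 2 * (1 - s ^+ 2) +
  (z * n ^+ 2 * (u ^+ 2 + 2 * u * s + 1) - 2 * D * (u - s)) *
  (D - n * s - n * u * s ^+ 2)).
  by rewrite /A /hn /w /b /k; field.
rewrite mulr_ge0_le0//.
  by rewrite divr_ge0 ?sqr_ge0// mulr_ge0 ?exprn_ge0// ltW.
by apply: key_polynomial_le0 => //; rewrite (ltW n0).
Qed.

(** The choice of (k, b) in each range of p, with the resulting constants
    k / p. *)
Lemma key_parameters p m : 1 < p -> 1 <= m ->
  exists k b, [/\ 0 < k, key_inequality p m k b &
  [/\ p <= 4 / 3 -> k / p >= 1 / (4 * (p / (p - 1))),
      4 / 3 < p <= 2 -> k / p >=
        (2 * (8 - 3 * p) + 2 * Num.sqrt (p / (p - 1) * (8 - 3 * p)))^-1,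
      2 < p <= 2 * m ^+ 2 ->
        k / p = 1 / Num.sqrt 2 * (1 / (Num.sqrt 2 * p + 2 * Num.sqrt p))
    & p > 2 * m ^+ 2 -> k / p = (p / m + 2 * p + 2 * m)^-1]].
Proof.
move=> p1 m1.
have p0 : 0 < p by lra.
have pn : p != 0 by rewrite gt_eqF.
have m0 : 0 < m by lra.
have mn0 : m != 0 by rewrite gt_eqF.
have m2 : 1 <= m ^+ 2 by rewrite exprn_ege1.
have [p2|p2] := leP p 2.
  have q0 : 0 < p - 1 by lra.
  have qn : p - 1 != 0 by rewrite gt_eqF.
  exists ((p - 1) / 4), (3 * (p - 1) / 4); split.
  - by rewrite divr_gt0.
  - by apply: key_inequality_le2; rewrite // p1.
  have E : (p - 1) / 4 / p = (4 * (p / (p - 1)))^-1.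
    by field; rewrite ?pn ?qn.
  split; [by rewrite E div1r| |by move=> ?; lra|by move=> ?; lra].
  move=> /andP[p43 _]; rewrite E.
  have r0 : 0 < p / (p - 1) by rewrite divr_gt0.
  have rle : p / (p - 1) <= 8 - 3 * p by rewrite ler_pdivrMr//; nra.
  have sq : p / (p - 1) <= Num.sqrt (p / (p - 1) * (8 - 3 * p)).
    rewrite -[leLHS](ger0_norm (ltW r0)) -sqrtr_sqr ler_wsqrtr//.
    by rewrite expr2 ler_wpM2l// ltW.
  by rewrite lef_pV2 ?posrE; lra.
have [pm|pm] := leP p (2 * m ^+ 2).
  pose a := Num.sqrt 2 : R; pose c := Num.sqrt p.
  have s2 : 0 < a by rewrite sqrtr_gt0.
  have sp : 0 < c by rewrite sqrtr_gt0.
  have e2 : a ^+ 2 = 2 :> R by rewrite sqr_sqrtr.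
  have ep : c ^+ 2 = p by rewrite sqr_sqrtr// ltW.
  pose n := a / c.
  have n2 : n ^+ 2 = 2 / p by rewrite expr_div_n e2 ep.
  have n0 : 0 < n by rewrite divr_gt0.
  have n1 : n <= 1 by rewrite ler_pdivrMr// mul1r ler_wsqrtr// ltW.
  have nm : m^-1 <= n.
    rewrite -(@ler_pXn2r _ 2) ?nnegrE ?invr_ge0 ?(ltW m0) ?(ltW n0)//.
    by rewrite n2 exprVn ler_pdivlMr// mulrC ler_pdivrMr ?exprn_gt0.
  exists (1 + (1 + n * (1 + 1)))^-1, ((1 + n * (1 + 1)) / (1 + (1 + n * (1 +
    1)))).
  split.
  - by rewrite invr_gt0; lra.
  - apply: (@key_inequality_ge2 p m n 1) => //;
    rewrite ?n0 ?lexx ?ler01 ?(ltW p2)//.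
    by rewrite n2; field.
  split; [by move=> ?; lra|by move=> /andP[_ ?]; lra| |by move=> ?; lra].
  move=> _; rewrite -/a -/c /n -ep.
  have -> : 1 / a * (1 / (a * c ^+ 2 + 2 * c)) = (a ^+ 2 * c ^+ 2 +
    2 * a * c)^-1.
    field; rewrite !gt_eqF// ?addr_gt0 ?mulr_gt0 ?exprn_gt0//.
  rewrite e2; field.
  rewrite !gt_eqF// ?addr_gt0 ?mulr_gt0 ?exprn_gt0//.
pose n := m^-1; pose z := 2 * m ^+ 2 / p.
have n0 : 0 < n by rewrite invr_gt0.
have z0 : 0 <= z by rewrite divr_ge0 ?(ltW p0)// mulr_ge0// sqr_ge0.
have z1 : z <= 1 by rewrite ler_pdivrMr// mul1r ltW.
have nz0 : 0 <= n * (1 + z) by rewrite mulr_ge0 ?(ltW n0)// addr_ge0.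
exists (1 + (1 + n * (1 + z)))^-1, ((1 + n * (1 + z)) / (1 + (1 + n * (1 +
  z)))).
split.
- by rewrite invr_gt0; lra.
- apply: (@key_inequality_ge2 p m n z) => //; rewrite ?n0 ?z0 ?(ltW p2)//.
    by rewrite invf_le1.
  by rewrite /z /n; field; rewrite mn0 pn.
split; [by move=> ?; lra|by move=> /andP[_ ?]; lra|by move=> /andP[_ ?]; lra|].
move=> _; rewrite /z /n; field.
rewrite ?pn ?mn0 !gt_eqF ?addr_gt0 ?mulr_gt0 ?exprn_gt0//.
Qed.
End key.

(** * Iterated integrals of uniformly continuous functions *)

Section rV_norm.
Variable R : realType.

Lemma rV_norm_le k (v : 'rV[R]_k) (d : R) : 0 <= d ->
  (`|v| <= d) <-> forall j, `|v 0 j| <= d.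
Proof.
move=> d0; rewrite /Num.norm/= mx_normrE; split=> [/bigmax_leP[_ h] j|h].
  exact: (h (0, j)).
by apply/bigmax_leP; split=> // -[i j] _ /=; rewrite (ord1 i); exact: h.
Qed.

Lemma row_mx_norm_le k (a : 'rV[R]_1) (v : 'rV[R]_k) (d : R) : 0 <= d ->
  (`|row_mx a v : 'rV[R]_(1 + k)| <= d) <-> `|a 0 0| <= d /\ `|v| <= d.
Proof.
move=> d0; rewrite !rV_norm_le//; split=> [h|[ha hv] j].
  split=> [|j]; first by have := h (lshift k 0); rewrite row_mxEl.
  by have := h (rshift 1 j); rewrite row_mxEr.
have [l ->|l ->] := split_ordP j; first by rewrite row_mxEl ord1.
by rewrite row_mxEr.
Qed.

End rV_norm.

Section uc_in_ball.
Variable R : realType.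
Local Notation mu := (@lebesgue_measure R).

(** Uniform continuity, rather than continuity, is what passes to integrals
    over slices without any compactness argument. *)
Definition uc_in_ball k (M : R) (f : 'rV[R]_k -> R) : Prop :=
  (forall e : R, 0 < e -> exists2 d : R, 0 < d &
     forall v w, `|v - w| <= d -> `|f v - f w| <= e) /\
  (forall v, M < `|v| -> f v = 0).

Definition rintegral k (f : 'rV[R]_k -> R) : R :=
  fine (integral_rV (fun v => (f v)%:E)).

Definition slice k (f : 'rV[R]_k.+1 -> R) (t : R) (v : 'rV[R]_k) : R :=
  f (row_mx t%:M v : 'rV[R]_(1 + k)).

Lemma uc_in_ball_comb k M (a b : R) (f g : 'rV[R]_k -> R) :
  uc_in_ball M f -> uc_in_ball M g -> uc_in_ball M (fun v => a * f v + b * g v).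
Proof.
move=> [fu f0] [gu g0]; split=> [e e0|v Mv]; last
  by rewrite f0// g0// !mulr0 addr0.
have a0 : 0 < `|a| + 1 by rewrite ltr_wpDl.
have b0 : 0 < `|b| + 1 by rewrite ltr_wpDl.
have e2 : 0 < e / 2 by rewrite divr_gt0.
have [d d0 fd] := fu (e / 2 / (`|a| + 1)) (divr_gt0 e2 a0).
have [d' d'0 gd] := gu (e / 2 / (`|b| + 1)) (divr_gt0 e2 b0).
exists (Num.min d d'); first by rewrite lt_min d0.
move=> v w; rewrite le_min => /andP[/fd fvw /gd gvw].
have -> : a * f v + b * g v - (a * f w + b * g w) =
  a * (f v - f w) + b * (g v - g w) by ring.
apply: (le_trans (ler_normD _ _)); rewrite !normrM [leRHS]splitr lerD//.
  move: fvw; rewrite ler_pdivlMr// => h; apply: le_trans h.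
  by rewrite mulrC ler_wpM2l// lerDl.
move: gvw; rewrite ler_pdivlMr// => h; apply: le_trans h.
by rewrite mulrC ler_wpM2l// lerDl.
Qed.

Lemma uc_in_ball_slice k M (f : 'rV[R]_k.+1 -> R) t : 0 <= M ->
  uc_in_ball M f -> uc_in_ball M (slice f t).
Proof.
move=> M0 [fu f0]; split=> [e e0|v Mv].
  have [d d0 fd] := fu e e0; exists d => // v w vw.
  apply: fd; rewrite /slice -[X in `|X|]/(_ - _ : 'rV_(1 + k)).
  rewrite opp_row_mx add_row_mx subrr.
  by apply/(row_mx_norm_le _ _ (ltW d0)); split; rewrite // mxE normr0 ltW.
apply: f0; rewrite ltNge; apply/negP => /row_mx_norm_le -/(_ M0) [_].
by rewrite leNgt Mv.
Qed.

Lemma slice_out k M (f : 'rV[R]_k.+1 -> R) t v : 0 <= M ->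
  uc_in_ball M f -> M < `|t| -> slice f t v = 0.
Proof.
move=> M0 [fu f0] Mt; apply: f0; rewrite ltNge; apply/negP.
by move=> /row_mx_norm_le -/(_ M0) [+ _]; rewrite mxE eqxx mulr1n leNgt Mt.
Qed.

Lemma slice_near k M (f : 'rV[R]_k.+1 -> R) (e : R) : uc_in_ball M f -> 0 < e ->
  exists2 d : R, 0 < d & forall (t t' : R) v, `|t - t'| <= d ->
    `|slice f t v - slice f t' v| <= e.
Proof.
move=> [fu _] e0; have [d d0 fd] := fu e e0; exists d => // t t' v tt'.
apply: fd; rewrite /slice -[X in `|X|]/(_ - _ : 'rV_(1 + k)).
rewrite opp_row_mx add_row_mx subrr.
by apply/(row_mx_norm_le _ _ (ltW d0)); split;
  rewrite ?normr0 ?(ltW d0)// !mxE eqxx !mulr1n.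
Qed.

Lemma integral_vanishing_outside (g : R -> R) M : 0 <= M -> continuous g ->
  (forall t, M < `|t| -> g t = 0) ->
  (\int[mu]_t (g t)%:E)%E = (\int[mu]_(t in `[(- M), M]) g t)%R%:E /\
  mu.-integrable `[(- M), M] (EFin \o g).
Proof.
move=> M0 cg g0.
have ig : mu.-integrable `[(- M), M] (EFin \o g).
  apply: continuous_compact_integrable; first exact: segment_compact.
  exact: continuous_subspaceT.
split=> //; rewrite fineK; last exact: integrable_fin_num.
rewrite [RHS]integral_mkcond; apply: eq_integral => t _.
rewrite patchE; case: ifPn => //; rewrite notin_setE/= in_itv/= -ler_norml.
by move=> /negP; rewrite -ltNge => /g0 ->.
Qed.

(** The properties that make the induction on the dimension go through; the
    last one, the bound by the supremum times the volume of a cube, gives the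
    continuity of the integrals over slices. *)
Definition rintegral_spec k M : Prop :=
  [/\ forall f : 'rV[R]_k -> R, uc_in_ball M f ->
        integral_rV (fun v => (f v)%:E) = (rintegral f)%:E,
      forall a b (f g : 'rV[R]_k -> R), uc_in_ball M f -> uc_in_ball M g ->
        rintegral (fun v => a * f v + b * g v) = a * rintegral f +
          b * rintegral g,
      forall f : 'rV[R]_k -> R, uc_in_ball M f -> (forall v, 0 <= f v) ->
        0 <= rintegral f
    & forall (f : 'rV[R]_k -> R) (B : R), uc_in_ball M f ->
      (forall v, `|f v| <= B) ->
        `|rintegral f| <= B * (2 * M) ^+ k].

Section step.
Variables (k : nat) (M : R) (f : 'rV[R]_k.+1 -> R).
Hypotheses (M0 : 0 <= M) (spec : rintegral_spec k M) (uf : uc_in_ball M f).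

Lemma rintegral_slice_continuous : continuous (fun t => rintegral (slice f t)).
Proof.
have [_ lin _ bnd] := spec.
move=> t; apply/cvgrPdist_le => e e0.
have c0 : 0 < (2 * M) ^+ k + 1 by rewrite ltr_wpDl// exprn_ge0// mulr_ge0.
have [d d0 fd] := slice_near uf (divr_gt0 e0 c0).
near=> t'.
have tt' : `|t - t'| <= d by near: t'; exact: cvgr_dist_le.
have := bnd (fun v => 1 * slice f t v + (-1) * slice f t' v) (e / ((2 *
  M) ^+ k + 1)).
rewrite lin; [|exact: uc_in_ball_slice..].
rewrite mul1r mulN1r => h; apply: le_trans.
  apply: h; first by apply: uc_in_ball_comb; exact: uc_in_ball_slice.
  by move=> v; rewrite mul1r mulN1r; exact: fd.
by rewrite -mulrA ler_piMr ?(ltW e0)// mulrC ler_pdivrMr// mul1r lerDl.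
Unshelve. all: by end_near. Qed.

Lemma rintegral_slice_out t : M < `|t| -> rintegral (slice f t) = 0.
Proof.
have [_ lin _ _] := spec.
move=> Mt; have -> : slice f t = (fun v => 0 * slice f t v + 0 * slice f t v).
  by apply/funext => v; rewrite (slice_out v M0 uf Mt) !mulr0 addr0.
rewrite lin; [|exact: uc_in_ball_slice..].
by rewrite !mul0r addr0.
Qed.

Lemma integral_rV_slice : integral_rV (fun v => (f v)%:E) =
  (\int[mu]_(t in `[(- M), M]) rintegral (slice f t))%R%:E.
Proof.
have [fin _ _ _] := spec.
have [<- _] := integral_vanishing_outside M0 rintegral_slice_continuous
  rintegral_slice_out.
by apply: eq_integral => t _; rewrite -fin//; exact: uc_in_ball_slice.
Qed.

Lemma rintegral_slice : rintegral f = \int[mu]_(t in `[(- M),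
  M]) rintegral (slice f t).
Proof. by rewrite {1}/rintegral integral_rV_slice. Qed.

Lemma integrable_rintegral_slice :
  mu.-integrable `[(- M), M] (EFin \o (fun t => rintegral (slice f t))).
Proof.
by have [_] := integral_vanishing_outside M0 rintegral_slice_continuous
  rintegral_slice_out.
Qed.

End step.

Lemma rintegral_specP k M : 0 <= M -> rintegral_spec k M.
Proof.
move=> M0; elim: k => [|k IH].
  split=> [f _|a b f g _ _|f _ f0|f B _ fB] //; first exact: f0.
  by rewrite mulr1; exact: fB.
have [fin lin pos bnd] := IH.
have int f uf := @integrable_rintegral_slice k M f M0 IH uf.
have JE f uf := @rintegral_slice k M f M0 IH uf.
split.
- by move=> f uf; rewrite (integral_rV_slice M0 IH uf) JE.
- move=> a b f g uf ug; rewrite !JE//; last exact: uc_in_ball_comb.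
  rewrite -!RintegralZl//; try exact: int.
  rewrite -RintegralD//; last 2 first.
    apply: eq_integrable (integrableZl _ a (int f uf)) => //.
    apply: eq_integrable (integrableZl _ b (int g ug)) => //.
  apply: eq_Rintegral => t _; rewrite -lin//; exact: uc_in_ball_slice.
- move=> f uf f0; rewrite JE//; apply: Rintegral_ge0 => t _.
  by apply: pos => [|v]; [exact: uc_in_ball_slice|exact: f0].
- move=> f B uf fB; rewrite JE//.
  apply: (le_trans (le_normr_Rintegral _ (int f uf))) => //.
  apply: (@le_trans _ _ (\int[mu]_(t in `[(- M), M]) (B * (2 * M) ^+ k))).
    apply: le_Rintegral => //.
    + exact: integrable_norm (int f uf).
    + apply: continuous_compact_integrable; first exact: segment_compact.
      by apply: continuous_subspaceT => x; exact: cvg_cst.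
    + move=> t _; apply: bnd; first exact: uc_in_ball_slice.
      by move=> v; exact: fB.
  rewrite Rintegral_cst//.
  have mE : mu `[(- M), M] = (2 * M)%:E.
    rewrite lebesgue_measure_itv/= lte_fin; case: ifPn => [_|].
      by rewrite -EFinD opprK; congr _%:E; lra.
    rewrite -leNgt => MM; have -> : M = 0 by lra.
    by rewrite mulr0.
  by rewrite [fine _](congr1 fine mE) /= exprSr [leRHS]mulrA.
Qed.


Lemma uc_in_ball_widen k M M' (f : 'rV[R]_k -> R) : M <= M' ->
  uc_in_ball M f -> uc_in_ball M' f.
Proof. by move=> MM [fu f0]; split=> // v /(le_lt_trans MM)/f0. Qed.

Lemma row_mx_addl k (t h : R) (v : 'rV[R]_k) :
  (row_mx t%:M v : 'rV[R]_(1 + k)) + h *: delta_mx 0 (lshift k 0) =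
  row_mx (t + h)%:M v.
Proof.
rewrite delta_mx_lshift scale_row_mx add_row_mx scaler0 addr0; congr row_mx.
by apply/matrixP => i j; rewrite !ord1 !mxE/= mulr1 !mulr1n.
Qed.

Lemma row_mx_addr k (t h : R) (v : 'rV[R]_k) j :
  (row_mx t%:M v : 'rV[R]_(1 + k)) + h *: delta_mx 0 (rshift 1 j) =
  row_mx t%:M (v + h *: delta_mx 0 j).
Proof. by rewrite delta_mx_rshift scale_row_mx add_row_mx scaler0 addr0. Qed.

Definition has_partial k (i : 'I_k) (f D : 'rV[R]_k -> R) : Prop :=
  forall v, is_derive (0 : R) 1 (fun h : R => f (v + h *: delta_mx 0 i)) (D v).

Lemma has_partial_line k (i : 'I_k) (f D : 'rV[R]_k -> R) v (h : R) :
  has_partial i f D ->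
  is_derive (h : R) 1 (fun h : R => f (v + h *: delta_mx 0 i))
    (D (v + h *: delta_mx 0 i)).
Proof.
move=> fD; pose g (x : R) := f (v + h *: delta_mx 0 i + x *: delta_mx 0 i).
have gh : is_derive (h - h) 1 g (D (v + h *: delta_mx 0 i)).
  by rewrite subrr; exact: fD.
have sh : is_derive h 1 (fun x : R => x - h) 1.
  exact: (is_derive_shift h 1 (- h)).
have := @is_derive1_comp R g (fun x => x - h) h _ _ gh sh; rewrite mulr1.
have -> // : g \o (fun x => x - h) = (fun h => f (v + h *: delta_mx 0 i)).
by apply/funext => x; rewrite /g/= -addrA -scalerDl subrKC.
Qed.

(** Differentiability from an estimate of the first-order remainder. *)
Lemma is_derive_remainder (g : R -> R) (t l : R) :
  (forall e : R, 0 < e -> exists2 d : R, 0 < d &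
     forall h : R, `|h| <= d -> `|g (t + h) - g t - h * l| <= e * `|h|) ->
  is_derive t 1 g l.
Proof.
move=> H.
have cv : h^-1 *: (g (h *: 1 + t) - g t) @[h --> (0 : R)^'] --> l.
  apply/cvgrPdist_le => e e0; have [d d0 hd] := H e e0.
  near=> h.
  have hn0 : h != 0 by near: h; exact: nbhs_dnbhs_neq.
  have {}hd : `|g (t + h) - g t - h * l| <= e * `|h|.
    by apply: hd; near: h; exact: dnbhs0_le.
  rewrite -(ler_pM2r (_ : 0 < `|h|)) ?normr_gt0// -normrM.
  apply: le_trans hd; rewrite -normrN /GRing.scale/= mulr1 (addrC h t).
  by rewrite le_eqVlt; apply/orP; left; apply/eqP; congr `|_|; field.
by apply: DeriveDef; [apply/cvg_ex; exists l|exact: cvg_lim].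
Unshelve. all: by end_near. Qed.

(** By the mean value theorem and the uniform continuity of D, difference
    quotients converge uniformly; this allows differentiation under the
    integral sign. *)
Lemma partial_remainder k (i : 'I_k) (M : R) (f D : 'rV[R]_k -> R) (e : R) :
  uc_in_ball M D -> has_partial i f D -> 0 < e ->
  exists2 d : R, 0 < d & forall v (h : R), `|h| <= d ->
    `|f (v + h *: delta_mx 0 i) - f v - h * D v| <= e * `|h|.
Proof.
move=> [Du _] fD e0; have [d d0 Dd] := Du e e0.
have dle h : `|h *: delta_mx 0 i : 'rV[R]_k| <= `|h|.
  apply/rV_norm_le => // j; rewrite !mxE normrM eqxx/= ler_piMr//.
  by case: (j == i); rewrite ?normr1 ?normr0.
exists d => // v h hd.
pose g (h : R) := f (v + h *: delta_mx 0 i).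
pose dg (h : R) := D (v + h *: delta_mx 0 i).
have gE (x : R) : is_derive x 1 g (dg x) by exact: has_partial_line.
have cg a b : {within `[a, b], continuous g}.
  apply: derivable_within_continuous => y _.
  by have [] := gE y.
have [c cd E] : exists2 c : R, `|c| <= d & g h - g 0 = dg c * h.
  have [h0|h0] := leP 0 h.
    have [c] := @MVT_segment R g dg 0 h h0 (fun x _ => gE x) (cg _ _).
    rewrite in_itv/= subr0 => /andP[c0 ch] E; exists c => //.
    by rewrite ger0_norm// (le_trans ch)// (le_trans (ler_norm h)).
  have [c] := @MVT_segment R g dg h 0 (ltW h0) (fun x _ => gE x) (cg _ _).
  rewrite in_itv/= => /andP[ch c0] E; exists c; last by lra.
  rewrite ler0_norm// (le_trans _ hd)// ler0_norm ?(ltW h0)//.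
  by rewrite lerN2.
have -> : f v = g 0 by rewrite /g scale0r addr0.
rewrite -/(g h) E mulrC -mulrBr normrM mulrC ler_wpM2r//.
apply: Dd; rewrite (addrC v) addrK.
exact: le_trans (dle _) _.
Qed.

(** Induction on the dimension.  If the derivative is along an inner
    coordinate, the integral over each slice vanishes.  If it is along the
    outer coordinate, the integrals over slices of D are the derivative of
    those of f, and the fundamental theorem of calculus applies. *)
Lemma rintegral_partial k (M : R) (i : 'I_k) (f D : 'rV[R]_k -> R) : 0 <= M ->
  uc_in_ball M f -> uc_in_ball M D -> has_partial i f D -> rintegral D = 0.
Proof.
elim: k => [|k IH] in M i f D *; first by case: i.
move=> M0 uf uD fD.
(* In the larger ball, the slices of f at the end points of the interval of
   integration vanish. *)
have M10 : 0 <= M + 1 by rewrite addr_ge0.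
have spec := rintegral_specP k M10.
have MM : M <= M + 1 by rewrite lerDl.
have uf1 := uc_in_ball_widen MM uf; have uD1 := uc_in_ball_widen MM uD.
rewrite (rintegral_slice M10 spec uD1).
have [l il|j ij] := @split_ordP 1 k i; last first.
  transitivity (\int[mu]_(t in `[(- (M + 1)), (M + 1)]) (cst 0 t : R)).
    apply: eq_Rintegral => t _ /=.
    apply: (IH M j (slice f t)) => //; [exact: uc_in_ball_slice..|].
    move=> v; have := fD (row_mx t%:M v); rewrite ij.
    have -> // : (fun h : R => f (row_mx t%:M v + h *: delta_mx 0 (rshift 1 j)))
      = (fun h => slice f t (v + h *: delta_mx 0 j)).
    by apply/funext => h; rewrite /slice -row_mx_addr.
  by rewrite Rintegral_cst ?mul0r.
have {}il : i = @lshift 1 k 0 by rewrite il (ord1 l).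
pose I t := rintegral (slice f t).
have [_ lin _ bnd] := spec.
have dI (t : R) : is_derive t 1 I (rintegral (slice D t)).
  apply: is_derive_remainder => e e0.
  have c0 : 0 < (2 * (M + 1)) ^+ k + 1
    by rewrite ltr_wpDl// exprn_ge0// mulr_ge0.
  have [d d0 fd] := partial_remainder uD fD (divr_gt0 e0 c0).
  exists d => // h hd.
  pose r v := 1 * (1 * slice f (t + h) v + (-1) * slice f t v) +
    (- h) * slice D t v.
  have ufs x := uc_in_ball_slice x M10 uf1.
  have uDs x := uc_in_ball_slice x M10 uD1.
  have -> : I (t + h) - I t - h * rintegral (slice D t) = rintegral r.
    rewrite /r lin//; last exact: uc_in_ball_comb.
    by rewrite lin// /I; ring.
  apply: (@le_trans _ _ (e / ((2 * (M + 1)) ^+ k + 1) * `|h| * (2 * (M +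
    1)) ^+ k)).
    apply: bnd; first by apply: uc_in_ball_comb => //; exact: uc_in_ball_comb.
    move=> v; have := fd (row_mx t%:M v) h hd.
    rewrite il row_mx_addl /r /slice.
    by rewrite !mul1r mulN1r mulNr.
  set c := _ ^+ k in c0 *.
  have -> : e / (c + 1) * `|h| * c = e * `|h| * (c / (c + 1)).
    by field; rewrite gt_eqF.
  rewrite ler_piMr ?mulr_ge0 ?(ltW e0)//.
  by rewrite ler_pdivrMr// mul1r lerDl.
have cI := rintegral_slice_continuous M10 spec uf1.
have spec0 := rintegral_specP k M0.
have I0 t : `|t| = M + 1 -> I t = 0.
  by move=> tM; rewrite /I (rintegral_slice_out M0 spec0 uf)// tM ltrDl.
have M1 : - (M + 1) < M + 1 by lra.
have cD : {within `[- (M + 1), M + 1], continuous (fun t =>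
  rintegral (slice D t))}.
  by apply: continuous_subspaceT;
    exact: (rintegral_slice_continuous M10 spec uD1).
have LR : derivable_oo_LRcontinuous I (- (M + 1)) (M + 1).
  split; first by move=> x _; have [] := dI x.
    by apply: cvg_at_right_filter; exact: cI.
  by apply: cvg_at_left_filter; exact: cI.
have dE : {in `]- (M + 1), M + 1[, I^`()%classic =1 (fun t =>
  rintegral (slice D t))}.
  by move=> x _; rewrite derive1E; have [_ ->] := dI x.
have := continuous_FTC2 M1 cD LR dE.
rewrite !I0 ?normrN ?ger0_norm// subee// => /(congr1 fine).
by [].
Qed.

End uc_in_ball.

(** * Powers of absolute values and compactly supported functions *)

Section abs_power.
Variable R : realType.
Implicit Types q t p : R.

Lemma continuous_norm_powR q : 0 < q -> continuous (fun t : R => `|t| `^ q).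
Proof.
move=> q0 t; have [->|t0] := eqVneq t 0.
  apply/cvgrPdist_le => e e0.
  have d0 : 0 < e `^ q^-1 by rewrite powR_gt0.
  near=> s; rewrite normr0 powR0 ?gt_eqF// sub0r normrN ger0_norm ?powR_ge0//.
  have : `|s| <= e `^ q^-1.
    by rewrite -normrN -sub0r; near: s; exact: cvgr_dist_le.
  move=> /(@ge0_ler_powR R q (ltW q0)); rewrite !nnegrE normr_ge0 powR_ge0.
  by rewrite -powRrM mulVf ?gt_eqF// powRr1 ?(ltW e0)//; apply.
have nt : 0 < `|t| by rewrite normr_gt0.
have c : {for `|t|, continuous (fun x : R => x `^ q)}.
  apply: differentiable_continuous; apply/derivable1_diffP.
  by have [] := is_derive1_powR q nt.
exact: continuous_comp (@norm_continuous _ _ t) c.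
Unshelve. all: by end_near. Qed.

(** The function sgn (t) |t|^q, as a difference of powers of the positive and
    negative parts, whence its continuity. *)
Definition sgn_powR q t : R := ((`|t| + t) / 2) `^ q - ((`|t| - t) / 2) `^ q.

Lemma continuous_sgn_powR q : 0 < q -> continuous (sgn_powR q).
Proof.
move=> q0 t.
have h (g : R -> R) : (forall x, 0 <= g x) -> continuous g ->
  {for t, continuous (fun x => g x `^ q)}.
  move=> g0 cg.
  have -> : (fun x => g x `^ q) = (fun x => `|x| `^ q) \o g.
    by apply/funext => x /=; rewrite ger0_norm.
  by apply: continuous_comp; [exact: cg|exact: continuous_norm_powR].
apply: cvgB; apply: h.
- by move=> x; rewrite divr_ge0//; have := ler_norm (- x); rewrite normrN; lra.
- move=> x; apply: cvgMl; apply: cvgD; [exact: norm_continuous|exact: cvg_id].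
- by move=> x; rewrite divr_ge0//; have := ler_norm x; lra.
- move=> x; apply: cvgMl; apply: cvgB; [exact: norm_continuous|exact: cvg_id].
Qed.

Lemma sgn_powR_ge0 q t : q != 0 -> 0 <= t -> sgn_powR q t = t `^ q.
Proof.
move=> q0 t0; rewrite /sgn_powR ger0_norm// subrr mul0r powR0// subr0.
by congr powR; lra.
Qed.

Lemma sgn_powR_le0 q t : q != 0 -> t <= 0 -> sgn_powR q t = - (- t) `^ q.
Proof.
move=> q0 t0; rewrite /sgn_powR ler0_norm// addNr mul0r powR0// sub0r.
by congr (- powR _ _); lra.
Qed.

Lemma normr_sgn_powR q t : q != 0 -> `|sgn_powR q t| = `|t| `^ q.
Proof.
move=> q0; have [t0|t0] := leP 0 t.
  by rewrite sgn_powR_ge0// (ger0_norm t0) ger0_norm ?powR_ge0.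
by rewrite sgn_powR_le0 ?ltW// normrN (ltr0_norm t0) ger0_norm ?powR_ge0.
Qed.

Lemma is_derive_norm_powR p t : 1 < p ->
  is_derive t 1 (fun t : R => `|t| `^ p) (p * sgn_powR (p - 1) t).
Proof.
move=> p1; have q0 : 0 < p - 1 by lra.
have qn : p - 1 != 0 by rewrite gt_eqF.
have [t0|t0|->] := ltgtP t 0; last first.
- apply: is_derive_remainder => e e0.
  have d0 : 0 < e `^ (p - 1)^-1 by rewrite powR_gt0.
  exists (e `^ (p - 1)^-1) => // h hd.
  rewrite sgn_powR_ge0// powR0// !mulr0 subr0 add0r normr0 powR0 ?subr0;
    last first.
    by rewrite gt_eqF//; lra.
  rewrite ger0_norm ?powR_ge0// -mulr_powRB1//; last by lra.
  rewrite mulrC ler_wpM2r//.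
  move: hd => /(@ge0_ler_powR R (p - 1) (ltW q0)).
  rewrite !nnegrE normr_ge0 powR_ge0.
  by rewrite -powRrM mulVf// powRr1 ?(ltW e0)//; apply.
- rewrite sgn_powR_ge0 ?(ltW t0)//.
  apply: (@near_eq_is_derive _ _ _ (fun t : R => t `^ p)).
    near=> s; rewrite ger0_norm//; apply/ltW; near: s; exact: lt_nbhsr.
  exact: is_derive1_powR.
- rewrite sgn_powR_le0 ?(ltW t0)// mulrN -mulrN1.
  apply: (@near_eq_is_derive _ _ _ ((fun t : R => t `^ p) \o -%R)).
    by near=> s; rewrite ltr0_norm//; near: s; exact: lt_nbhsl.
  apply: is_derive1_comp.
  by apply: is_derive1_powR; rewrite oppr_gt0.
Unshelve. all: by end_near. Qed.

End abs_power.

Section compact_set.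
Variables (R : realType) (k : nat) (K : set 'rV[R]_k).
Hypothesis cK : compact K.

Lemma compact_rV_bounded : exists2 M : R, 0 <= M & forall v, K v -> `|v| <= M.
Proof.
have [M [_ HM]] := compact_bounded cK.
exists (`|M| + 1) => [|v Kv]; first by rewrite addr_ge0.
by apply: HM => //; rewrite ltr_pwDr// ler_norm.
Qed.

Lemma continuous_off (f : 'rV[R]_k -> R) :
  (forall v, K v -> {for v, continuous f}) -> (forall v, ~ K v -> f v = 0) ->
  continuous f.
Proof.
move=> fK f0 v; have [Kv|nKv] := pselect (K v); first exact: fK.
have cl : closed K by apply: compact_closed => //; exact: norm_hausdorff.
have nb : \near v, 0 = f v.
  near=> w; rewrite f0//; near: w.
  exact: open_nbhs_nbhs (conj (closed_openC cl) nKv).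
rewrite /continuous_at f0//; apply: (@cvg_trans _ (cst 0 @ v)).
  exact: near_eq_cvg nb.
exact: (@cst_continuous _ _ (0 : R) v).
Unshelve. all: by end_near. Qed.

(** The Heine-Cantor theorem for functions supported in K. *)
Lemma continuous_uc_in_ball M (f : 'rV[R]_k -> R) : (forall v, K v ->
  `|v| <= M) ->
  continuous f -> (forall v, ~ K v -> f v = 0) -> uc_in_ball M f.
Proof.
move=> KM cf f0; split; last first.
  by move=> v Mv; apply: f0 => /KM; rewrite leNgt Mv.
move=> e e0.
have := (compact_near_coveringP K).1 cK _ ((0 : R)^'+)
  (fun d v => forall w, `|v - w| <= d -> `|f v - f w| <= e) _.
case=> [|d /= d0 H].
  move=> v Kv.
  have /cvgrPdist_le/(_ (e / 2)) := cf v; rewrite divr_gt0// => /(_ isT).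
  move=> /nbhs_ballP[d /= d0 H].
  exists (ball v (d / 2), [set x | x < d / 2]) => /=.
    split; first by apply: nbhsx_ballx; rewrite divr_gt0.
    by apply: nbhs_right_lt; rewrite divr_gt0.
  move=> [x y] /= [vx yd] w xw.
  have -> : f x - f w = (f v - f w) - (f v - f x) by ring.
  move: vx; rewrite -ball_normE /= => vx.
  rewrite (le_trans (ler_normB _ _))// (splitr e) lerD//; apply: H.
    rewrite -ball_normE/=; have -> : v - w = (v - x) + (x - w)
      by rewrite addrA subrK.
    rewrite (le_lt_trans (ler_normD _ _))// (splitr d) ltrD//.
    exact: le_lt_trans yd.
  rewrite -ball_normE/= (lt_trans vx)//; lra.
have Hd : forall v, K v -> forall w, `|v - w| <= d / 2 -> `|f v - f w| <= e.
  move=> v Kv; apply: (H (d / 2)) => //=; last by rewrite divr_gt0.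
  by rewrite sub0r normrN gtr0_norm ?divr_gt0//; lra.
exists (d / 2); first by rewrite divr_gt0.
move=> v w vw; have [Kv|nKv] := pselect (K v); first exact: Hd.
have [Kw|nKw] := pselect (K w); first by rewrite distrC Hd// distrC.
by rewrite !f0// subrr normr0 ltW.
Qed.

End compact_set.

(** * The vector field *)

Section hardy_field.
Variables (R : realType) (j : nat) (k b : R).
Implicit Types x y p : R.

Local Notation m := (j%:R : R).

Definition rad x y : R := Num.sqrt (y ^+ 2 + x ^+ 2).
Definition sine x y : R := y / rad x y.
Definition cosine x y : R := x / rad x y.

(** The two components of W; the others are zero. *)
Definition field_x x y : R :=
  (y ^+ j)^-1 * (- (b / m) * (sine x y * cosine x y)).
Definition field_y x y : R :=
  (y ^+ j)^-1 * (1 - (k * sine x y + b * sine x y ^+ 2) / m).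

(** The derivatives of the components of W along x_1 and y respectively. *)
Definition dfield_x x y : R :=
  - (y ^+ j.+1)^-1 * (b / m * (sine x y ^+ 2 * (2 * sine x y ^+ 2 - 1))).
Definition dfield_y x y : R :=
  - (y ^+ j.+1)^-1 * (m - (k * sine x y + b * sine x y ^+ 2)
    + (k * sine x y + 2 * b * sine x y ^+ 2) * (1 - sine x y ^+ 2) / m).

Lemma rad_gt0 x y : 0 < y -> 0 < rad x y.
Proof. by move=> y0; rewrite sqrtr_gt0 ltr_pwDl ?exprn_gt0// sqr_ge0. Qed.

Lemma rad_sqr x y : rad x y ^+ 2 = y ^+ 2 + x ^+ 2.
Proof. by rewrite sqr_sqrtr// addr_ge0 ?sqr_ge0. Qed.

Lemma sine_itv x y : 0 < y -> 0 <= sine x y <= 1.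
Proof.
move=> y0; have r0 := rad_gt0 x y0.
rewrite divr_ge0 ?(ltW y0) ?(ltW r0)//= ler_pdivrMr// mul1r.
by rewrite -{1}(ger0_norm (ltW y0)) -sqrtr_sqr ler_wsqrtr// lerDl sqr_ge0.
Qed.

Lemma cosine_sqr x y : 0 < y -> cosine x y ^+ 2 = 1 - sine x y ^+ 2.
Proof.
move=> y0; have rn : rad x y != 0 by rewrite gt_eqF ?rad_gt0.
rewrite /cosine /sine !expr_div_n rad_sqr; field.
by rewrite -rad_sqr expf_neq0.
Qed.

Lemma is_derive_translate (g : R -> R) (y l : R) : is_derive y 1 g l ->
  is_derive (0 : R) 1 (fun h => g (y + h)) l.
Proof.
move=> gy.
have gy' : is_derive ((fun h => y + h) 0) 1 g l by rewrite /= addr0.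
have sh : is_derive (0 : R) 1 (fun h => y + h) 1.
  have := is_deriveD (is_derive_cst y (0 : R) 1) (is_derive_id (0 : R) 1).
  by rewrite add0r.
by have := @is_derive1_comp R g (fun h => y + h) 0 _ _ gy' sh; rewrite mulr1.
Qed.

Lemma is_derive_rad x y : 0 < y -> is_derive y 1 (rad x) (sine x y).
Proof.
move=> y0; have r0 := rad_gt0 x y0.
have d : is_derive y 1 (fun y => y ^+ 2 + x ^+ 2) (2 * y).
  by apply: is_derive_eq; rewrite /GRing.scale/=; ring.
have P0 : 0 < y ^+ 2 + x ^+ 2 by rewrite ltr_pwDl ?exprn_gt0// sqr_ge0.
have := @is_derive1_comp R Num.sqrt (fun y => y ^+ 2 + x ^+ 2) y _ _
  (is_derive1_sqrt P0) d.
have -> // : (2 * Num.sqrt (y ^+ 2 + x ^+ 2))^-1 * (2 * y) = sine x y.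
by rewrite /sine -/(rad x y); field; rewrite gt_eqF.
Qed.

Lemma is_derive_sine x y : 0 < y ->
  is_derive y 1 (sine x) (sine x y * (1 - sine x y ^+ 2) / y).
Proof.
move=> y0; have r0 := rad_gt0 x y0.
have rn : rad x y != 0 by rewrite gt_eqF.
have yn : y != 0 by rewrite gt_eqF.
have dV := is_deriveV rn (is_derive_rad x y0).
have := is_deriveM (is_derive_id y 1) dV.
have -> // : id y *: (- (rad x y) ^- 2 *: sine x y) + (rad x y)^-1 *: (1 : R)
  = sine x y * (1 - sine x y ^+ 2) / y.
by rewrite /GRing.scale/= /sine; field; rewrite rn yn.
Qed.

Lemma is_derive_exprnV y : 0 < y -> (0 < j)%N ->
  is_derive y 1 (fun y => (y ^+ j)^-1) (- m / y ^+ j.+1).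
Proof.
move=> y0 j0; have yn : y != 0 by rewrite gt_eqF.
have d : is_derive y 1 (fun y => y ^+ j) (m * y ^+ j.-1).
  have := is_deriveX j (is_derive_id y 1).
  rewrite exprfctE /GRing.scale/= mulr1.
  exact.
have yjn : y ^+ j != 0 by rewrite expf_neq0.
have := @is_deriveV R (fun y => y ^+ j) y _ _ yjn d.
have -> // : - (y ^+ j) ^- 2 *: (m * y ^+ j.-1) = - m / y ^+ j.+1.
rewrite /GRing.scale/= -(prednK j0) /= !exprS; field.
by rewrite yn expf_neq0.
Qed.

Lemma is_derive_field_y x y : 0 < y -> (0 < j)%N ->
  is_derive y 1 (field_y x) (dfield_y x y).
Proof.
move=> y0 j0; have yn : y != 0 by rewrite gt_eqF.
have mn : m != 0 by rewrite pnatr_eq0 -lt0n.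
have dq : is_derive (sine x y) 1 (fun t => 1 - (k * t + b * t ^+ 2) / m)
    (- (k + 2 * b * sine x y) / m).
  have h1 : is_derive (sine x y) 1 (fun t : R =>
    t * (k + b * t)) (k + 2 * b * sine x y).
    have h0 : is_derive (sine x y) 1 (fun t : R => b * t) (b * 1)
      by exact: is_deriveZ.
    have := is_deriveM (is_derive_id (sine x y) 1)
      (is_deriveD (is_derive_cst k (sine x y) 1) h0).
    move=> /is_derive_eq; apply.
    by rewrite /GRing.scale/= !fctE /cst/=; ring.
  have h2 := is_deriveZ m^-1 h1.
  have := is_deriveB (is_derive_cst (1 : R) (sine x y) 1) h2.
  have -> : (fun t => 1 - (k * t + b * t ^+ 2) / m) =
    cst 1 - m^-1 *: (fun t : R => t * (k + b * t)).
    by apply/funext => t; rewrite !fctE /GRing.scale/=; field; rewrite ?mn.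
  move=> /is_derive_eq; apply.
  by rewrite /GRing.scale/=; ring.
have := is_deriveM (is_derive_exprnV y0 j0)
  (is_derive1_comp dq (is_derive_sine x y0)).
move=> /is_derive_eq; apply.
rewrite /GRing.scale/= /dfield_y (exprS y j); field.
by rewrite ?yn ?mn ?expf_neq0.
Qed.

Lemma is_derive_field_x x y : 0 < y -> (0 < j)%N ->
  is_derive x 1 (field_x ^~ y) (dfield_x x y).
Proof.
move=> y0 j0; have yn : y != 0 by rewrite gt_eqF.
have mn : m != 0 by rewrite pnatr_eq0 -lt0n.
have P0 : 0 < y ^+ 2 + x ^+ 2 by rewrite ltr_pwDl ?exprn_gt0// sqr_ge0.
have rn : y ^+ 2 + x ^+ 2 != 0 by rewrite gt_eqF.
have e z : sine z y * cosine z y = y * (z / (y ^+ 2 + z ^+ 2)).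
  by rewrite -rad_sqr /sine /cosine; field; rewrite gt_eqF ?rad_gt0.
have -> : field_x^~ y = (fun z => ((y ^+ j)^-1 * - (b / m) * y) *
  (z / (y ^+ 2 + z ^+ 2))).
  by apply/funext => z; rewrite /field_x e; ring.
have yxx : is_derive x 1 (fun z => y ^+ 2 + z ^+ 2) (2 * x).
  by apply: is_derive_eq; rewrite /GRing.scale/=; ring.
have h1 := is_deriveM (is_derive_id x 1) (@is_deriveV R (fun z =>
  y ^+ 2 + z ^+ 2) x _ _ rn yxx).
have := is_deriveZ ((y ^+ j)^-1 * - (b / m) * y) h1.
move=> /is_derive_eq; apply.
rewrite /GRing.scale/= /dfield_x /sine expr_div_n rad_sqr (exprS y j); field.
by rewrite rn ?yn ?mn ?expf_neq0.
Qed.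

Lemma div_field x y : 0 < y -> dfield_x x y + dfield_y x y = - (y ^+ j.+1)^-1 *
  (m - sine x y * (k + b * sine x y)
   + (k * sine x y * (1 - sine x y ^+ 2) + b * sine x y ^+ 2) / m).
Proof. by move=> y0; rewrite /dfield_x /dfield_y; ring. Qed.

(** The pointwise form of the theorem: Cauchy-Schwarz for the cross term,
    Young's inequality with B = q |U| |y^m W|^(1/(p-1)), and the scalar
    inequality for the coefficient of |U|^p.  Here a1 and a2 stand for the
    derivatives of u along x_1 and y, and G for |grad u|. *)
Lemma pointwise_hardy p x y (U G a1 a2 : R) : 1 < p -> (0 < j)%N ->
  0 < y -> 0 <= G ->
  key_inequality p m k b ->
  a1 ^+ 2 + a2 ^+ 2 <= G ^+ 2 ->
  (m / p) `^ (p - 1) * (p * sgn_powR (p - 1) U * (a1 * field_x x y +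
    a2 * field_y x y)
     + `|U| `^ p * (dfield_x x y + dfield_y x y)) <=
  G `^ p / y `^ (j.+1%:R - p) - (m / p) `^ p * (`|U| `^ p / y ^+ j.+1)
  - (m / p) `^ (p - 2) * (k / p) * (`|U| `^ p / (y ^+ j * rad x y)).
Proof.
move=> p1 j0 y0 G0 key aG.
have yn : y != 0 by rewrite gt_eqF.
have p0 : 0 < p by lra.
have pn : p != 0 by rewrite gt_eqF.
have q0 : 0 < p - 1 by lra.
have qn : p - 1 != 0 by rewrite gt_eqF.
have m0 : 0 < m by rewrite ltr0n.
have mn : m != 0 by rewrite gt_eqF.
have r0 := rad_gt0 x y0.
have s01 := sine_itv x y0.
set s := sine x y in s01 *.
have key_s := key s s01.
set P := field_sqnorm m k b s in key_s *.
set X := Num.sqrt P `^ (p / (p - 1)) in key_s *.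
have P0 : 0 <= P by exact: field_sqnorm_ge0.
pose Y := (y ^+ j.+1)^-1.
have Y0 : 0 < Y by rewrite invr_gt0 exprn_gt0.
have YE : (y ^+ j)^-1 = y * Y by rewrite /Y exprS invfM mulrA divff// mul1r.
have W2 : field_x x y ^+ 2 + field_y x y ^+ 2 = (y * Y) ^+ 2 * P.
  have c2 := cosine_sqr x y0; rewrite -/s in c2.
  rewrite /field_x /field_y -/s YE; set c := cosine x y in c2 *.
  transitivity ((y * Y) ^+ 2 *
    ((1 - s * (k + b * s) / m) ^+ 2 + b ^+ 2 * s ^+ 2 * c ^+ 2 / m ^+ 2)).
    by field.
  by rewrite c2.
have CS : `|a1 * field_x x y + a2 * field_y x y| <= G * (y * Y * Num.sqrt P).
  have N0 : 0 <= G * (y * Y * Num.sqrt P).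
    by rewrite mulr_ge0// mulr_ge0 ?sqrtr_ge0// mulr_ge0 ?(ltW Y0) ?(ltW y0).
  rewrite -ler_sqr ?nnegrE// real_normK ?num_real//.
  rewrite [leRHS]exprMn [(y * Y * _) ^+ 2]exprMn sqr_sqrtr// -W2.
  apply: le_trans (ler_wpM2r _ aG); last by rewrite addr_ge0 ?sqr_ge0.
  rewrite -subr_ge0.
  have -> : (a1 ^+ 2 + a2 ^+ 2) * (field_x x y ^+ 2 + field_y x y ^+ 2)
      - (a1 * field_x x y + a2 * field_y x y) ^+ 2 =
    (a1 * field_y x y - a2 * field_x x y) ^+ 2 by ring.
  exact: sqr_ge0.
set Q := (m / p) `^ (p - 2).
have mp0 : 0 < m / p by rewrite divr_gt0.
have Q0 : 0 < Q by rewrite powR_gt0.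
have Q1 : (m / p) `^ (p - 1) = Q * (m / p).
  have e : p - 2 = p - 1 - 1 by ring.
  by rewrite [RHS]mulrC /Q e mulr_powRB1// ltW.
have Q2 : (m / p) `^ p = Q * (m / p) ^+ 2.
  by rewrite expr2 mulrA -Q1 [RHS]mulrC mulr_powRB1// ltW.
set V := `|U| `^ p.
have V0 : 0 <= V by rewrite powR_ge0.
have GY : G `^ p / y `^ (j.+1%:R - p) = (G * y) `^ p * Y.
  rewrite powRM ?(ltW y0)// powRB; last by rewrite yn implybT.
  rewrite powR_mulrn ?(ltW y0)// invf_div /Y; ring.
have mpU : 0 <= m / p * `|U| by rewrite mulr_ge0// ltW.
pose B := (m / p) * `|U| * Num.sqrt P `^ (p - 1)^-1.
have B1 : B `^ (p - 1) = Q * (m / p) * `|U| `^ (p - 1) * Num.sqrt P.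
  rewrite /B powRM ?powR_ge0// powRM ?(ltW mp0)// Q1.
  by rewrite -powRrM mulVf// powRr1 ?sqrtr_ge0.
have Bp : B `^ p = Q * (m / p) ^+ 2 * V * X.
  rewrite /B powRM ?powR_ge0// powRM ?(ltW mp0)// Q2.
  by rewrite -powRrM (mulrC _ p).
have B0 : 0 <= B by rewrite mulr_ge0 ?powR_ge0.
have young := young_powR p1 (mulr_ge0 G0 (ltW y0)) B0.
rewrite B1 Bp in young.
have cross : (m / p) `^ (p - 1) * (p * sgn_powR (p - 1) U * (a1 *
  field_x x y + a2 * field_y x y))
    <= Y * (p * (G * y) * (Q * (m / p) * `|U| `^ (p - 1) * Num.sqrt P)).
  have U0 : 0 <= `|U| `^ (p - 1) by exact: powR_ge0.
  rewrite Q1; set d := Q * (m / p).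
  have d0 : 0 <= d by rewrite mulr_ge0// ltW.
  apply: (le_trans (ler_norm _)).
  rewrite normrM (ger0_norm d0) normrM normrM normr_sgn_powR//.
  rewrite (ger0_norm (ltW p0)).
  have c0 : 0 <= d * (p * `|U| `^ (p - 1)) by rewrite mulr_ge0// mulr_ge0// ltW.
  have h := ler_wpM2l c0 CS.
  rewrite (mulrA d); apply: (le_trans h).
  by rewrite le_eqVlt; apply/orP; left; apply/eqP; ring.
rewrite mulrDr div_field// -/s -/Y GY Q2.
apply: (le_trans (lerD (le_trans cross (ler_wpM2l (ltW Y0) young)) (lexx _))).
have -> : (y ^+ j * rad x y)^-1 = Y * s.
  by rewrite invfM YE /s /sine; ring.
rewrite Q1 -/Y -subr_ge0.
have -> : (G * y) `^ p * Y - Q * (m / p) ^+ 2 * (V * Y) - Q * (k / p) * (V *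
  (Y * s)) -
  (Y * ((G * y) `^ p + (p - 1) * (Q * (m / p) ^+ 2 * V * X)) +
   Q * (m / p) * (V * (- Y * (m - s * (k + b * s) + (k * s * (1 - s ^+ 2) +
     b * s ^+ 2) / m))))
  = Q * V * Y / p * (s ^+ 2 * (b - k * s) -
     m ^+ 2 * ((p - 1) / p) * (X - 1 + p / (p - 1) * (s * (k + b * s)) / m)).
  by field; rewrite ?pn ?qn ?mn.
rewrite mulr_ge0 ?subr_ge0// divr_ge0 ?(ltW p0)// mulr_ge0 ?(ltW Y0)//.
by rewrite mulr_ge0 ?(ltW Q0).
Qed.

End hardy_field.

(** * Integration over the half-space *)

Section swap.
Variables (R : realType) (j : nat).

(** Integration over the half-space treats y as the outer variable, whereas a
    point is written with y last; moving y to the front turns it into an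
    iterated integral over R^(1 + j). *)
Definition swap (v : 'rV[R]_(1 + j)) : 'rV[R]_(j + 1) :=
  row_mx (rsubmx v) (lsubmx v).

Lemma swap_row_mx (a : 'rV[R]_1) v : swap (row_mx a v) = row_mx v a.
Proof. by rewrite /swap row_mxKr row_mxKl. Qed.

Lemma swapD v w : swap (v + w) = swap v + swap w.
Proof. by rewrite /swap !raddfD /= add_row_mx. Qed.

Lemma swapZ (h : R) v : swap (h *: v) = h *: swap v.
Proof. by rewrite /swap !linearZ /= scale_row_mx. Qed.

Lemma swapB v w : swap (v - w) = swap v - swap w.
Proof. by rewrite /swap !raddfB /= opp_row_mx add_row_mx. Qed.

Lemma swap_norm_le v (d : R) : 0 <= d -> (`|swap v| <= d) <-> (`|v| <= d).
Proof.
move=> d0; rewrite -{2}(hsubmxK v) row_mx_norm_le// !rV_norm_le//; split.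
  move=> h; split=> [|i].
    by have := h (rshift j 0); rewrite row_mxEr.
  by have := h (lshift 1 i); rewrite row_mxEl.
move=> [ha hv] i; have [l ->|l ->] := split_ordP i; first by rewrite row_mxEl.
by rewrite row_mxEr ord1.
Qed.

Lemma uc_in_ball_swap (M : R) (F : 'rV[R]_(j + 1) -> R) : 0 <= M ->
  uc_in_ball M F ->
  @uc_in_ball R (1 + j) M (F \o swap).
Proof.
move=> M0 [Fu F0]; split=> [e e0|v Mv].
  have [d d0 Fd] := Fu e e0; exists d => // v w vw.
  by apply: Fd; rewrite -swapB; apply/swap_norm_le => //; exact: ltW.
apply: F0; rewrite ltNge; apply/negP => /swap_norm_le -/(_ M0).
by rewrite leNgt Mv.
Qed.

Lemma integral_halfspace_swap (M : R) (F : 'rV[R]_(j + 1) -> R) : 0 <= M ->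
  uc_in_ball M F ->
  (forall z : 'rV[R]_(j + 1), z 0 (rshift j 0) <= 0 -> F z = 0) ->
  integral_halfspace (fun x y => F (row_mx x y%:M)) =
    (@rintegral R (1 + j) (F \o swap))%:E.
Proof.
move=> M0 uF F0; have [fin _ _ _] := rintegral_specP (1 + j) M0.
rewrite -fin; last exact: uc_in_ball_swap.
rewrite /integral_halfspace integral_mkcond /=.
apply: eq_integral => y _; rewrite patchE.
case: ifPn => [_|].
  by congr integral_rV; apply/funext => x /=; rewrite swap_row_mx.
rewrite notin_setE/= in_itv/= andbT => /negP; rewrite -leNgt => y0.
have [finj linj _ _] := rintegral_specP j M0.
have u0 : @uc_in_ball R j M (fun=> 0).
  by split=> // e e0; exists 1 => // v w _; rewrite subrr normr0 ltW.
have -> : (fun v : 'rV[R]_j => ((F \o swap) (row_mx y%:M v))%:E) = (fun=> 0%:E).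
  apply/funext => v /=; rewrite swap_row_mx F0//.
  by rewrite row_mxEr mxE eqxx mulr1n.
rewrite finj//.
have := linj 0 0 _ _ u0 u0; rewrite !mul0r addr0 => ->.
by [].
Qed.

Lemma has_partial_swap_y (F D : 'rV[R]_(j + 1) -> R) :
  has_partial (rshift j 0) F D ->
  @has_partial R (1 + j) (lshift j 0) (F \o swap) (D \o swap).
Proof.
move=> FD v /=; have := FD (swap v).
have -> // : (fun h : R => F (swap v + h *: delta_mx 0 (rshift j 0))) =
  (fun h => F (swap (v + h *: delta_mx 0 (lshift j 0)))).
apply/funext => h; rewrite swapD swapZ delta_mx_lshift swap_row_mx.
by rewrite delta_mx_rshift.
Qed.

Lemma has_partial_swap_x i (F D : 'rV[R]_(j + 1) -> R) :
  has_partial (lshift 1 i) F D ->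
  @has_partial R (1 + j) (rshift 1 i) (F \o swap) (D \o swap).
Proof.
move=> FD v /=; have := FD (swap v).
have -> // : (fun h : R => F (swap v + h *: delta_mx 0 (lshift 1 i))) =
  (fun h => F (swap (v + h *: delta_mx 0 (rshift 1 i)))).
apply/funext => h; rewrite swapD swapZ delta_mx_rshift swap_row_mx.
by rewrite delta_mx_lshift.
Qed.

End swap.

Section test_function.
Variables (R : realType) (k : nat) (u : 'rV[R]_k -> R).
Local Notation K := (closure [set z | u z != 0]).

Lemma derivable_has_partial i : (forall z, derivable u z (delta_mx 0 i)) ->
  has_partial i u (partial i u).
Proof.
move=> du z; set g := fun h : R => _.
have E : (fun h : R => h^-1 *: ((g \o shift 0) (h *: 1) - g 0)) =
  (fun h : R => h^-1 *: ((u \o shift z) (h *: delta_mx 0 i) - u z)).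
  apply/funext => h; rewrite /g /= addr0 scale0r addr0 [h *: 1]mulr1.
  by rewrite (addrC z).
apply: DeriveDef; first by have := du z; rewrite /derivable E.
by rewrite /derive E.
Qed.

Lemma closure_support0 z : ~ K z -> u z = 0.
Proof.
move=> nK; apply: contra_notP nK => /eqP uz; exact: subset_closure.
Qed.

Lemma near_support0 z : ~ K z -> \near z, 0 = u z.
Proof.
move=> nK; near=> w; rewrite closure_support0//; near: w.
apply: open_nbhs_nbhs; split => //.
by apply: closed_openC; exact: closed_closure.
Unshelve. all: by end_near. Qed.

Lemma partial_support0 i z : ~ K z -> partial i u z = 0.
Proof.
move=> nK; rewrite /partial -(near_eq_derive _ (near_support0 nK)).
exact: derive_cst.
Qed.

(** A product with a power of u is differentiable off the support of u,
    whatever its other factor, because it vanishes nearby. *)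
Lemma has_partial_off i (F D : 'rV[R]_k -> R) :
  (forall z, u z = 0 -> F z = 0) ->
  (forall z, K z -> is_derive (0 : R) 1 (fun h : R =>
    F (z + h *: delta_mx 0 i)) (D z)) ->
  (forall z, ~ K z -> D z = 0) -> has_partial i F D.
Proof.
move=> F0 FK D0 z; have [Kz|nKz] := pselect (K z); first exact: FK.
rewrite D0//.
apply: (@near_eq_is_derive _ _ _ (cst (0 : R))).
have c : (fun h : R => z + h *: delta_mx 0 i : 'rV[R]_k) @ (0 : R) -->
    z + (0 : R) *: delta_mx 0 i.
  apply: cvgD; first exact: cvg_cst.
  by apply: cvgZr_tmp; exact: cvg_id.
rewrite scale0r addr0 in c.
have := c _ (near_support0 nKz); rewrite /= => H.
near=> h; rewrite F0//.
by apply/esym; near: h; exact: H.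
Unshelve. all: by end_near. Qed.

End test_function.

Section cvg_helpers.
Variables (R : realType) (T : Type) (F : set_system T).
Context {FF : Filter F}.

Lemma cvg_exprn (f : T -> R) (a : R) e :
  f @ F --> a -> f w ^+ e @[w --> F] --> a ^+ e.
Proof.
move=> fa; apply: (@cvg_comp _ _ _ f (fun t : R => t ^+ e)); first exact: fa.
exact: exprn_continuous.
Qed.

Lemma cvg_sum_ord k (f : 'I_k -> T -> R) (a : 'I_k -> R) :
  (forall i, f i w @[w --> F] --> a i) ->
  \sum_i f i w @[w --> F] --> \sum_i a i.
Proof.
by move=> fa; apply: cvg_big => //; exact: add_continuous.
Qed.

Lemma cvg_norm_powR (f : T -> R) (a p : R) : 0 < p ->
  f @ F --> a -> `|f w| `^ p @[w --> F] --> `|a| `^ p.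
Proof.
move=> p0 fa; apply: (@cvg_comp _ _ _ f (fun t : R => `|t| `^ p)).
  exact: fa.
exact: continuous_norm_powR.
Qed.

End cvg_helpers.

(** Integration of a pointwise bound whose left-hand side is a divergence. *)
Lemma rintegral_ge (R : realType) d (M : R)
    (F1 F2 F3 G1 G2 : 'rV[R]_d -> R) (a c q : R) :
  0 <= M -> uc_in_ball M F1 -> uc_in_ball M F2 -> uc_in_ball M F3 ->
    uc_in_ball M G1 -> uc_in_ball M G2 ->
  rintegral G1 = 0 -> rintegral G2 = 0 ->
  (forall v, q * (G1 v + G2 v) <= F1 v - a * F2 v - c * F3 v) ->
  c * rintegral F3 <= rintegral F1 - a * rintegral F2.
Proof.
move=> M0 U1 U2 U3 V1 V2 J1 J2 le; have [_ lin pos _] := rintegral_specP d M0.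
have W1 := uc_in_ball_comb 1 (- a) U1 U2.
have W2 := uc_in_ball_comb 1 (- c) W1 U3.
have W3 := uc_in_ball_comb 1 1 V1 V2.
have W4 := uc_in_ball_comb 1 (- q) W2 W3.
have W0 v : 0 <= 1 * (1 * (1 * F1 v + (- a) * F2 v) + (- c) * F3 v)
    + (- q) * (1 * G1 v + 1 * G2 v) by have := le v; lra.
have := pos _ W4 W0; rewrite !lin// J1 J2; lra.
Qed.

Section hardy.
Variables (R : realType) (n : nat) (u : 'rV[R]_(n.+1 + 1) -> R).
Variables (p k b : R).
Hypotheses (p1 : 1 < p) (hu : Cc_infty (@halfspace R n.+1) u).
Hypothesis key : key_inequality p n.+1%:R k b.

Local Notation j := n.+1.
Local Notation m := (n.+1%:R : R).
Local Notation K := (closure [set z | u z != 0]).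
Local Notation iy := (rshift n.+1 0 : 'I_(n.+1 + 1)).
Local Notation ix := (lshift 1 0 : 'I_(n.+1 + 1)).
Implicit Type z : 'rV[R]_(n.+1 + 1).

Definition xcoord z : R := z 0 ix.
Definition ycoord z : R := z 0 iy.

Definition gradient_term z : R :=
  enorm (gradient u z) `^ p / ycoord z `^ (j.+1%:R - p).
Definition hardy_term z : R := `|u z| `^ p / ycoord z ^+ j.+1.
Definition remainder_term z : R :=
  `|u z| `^ p / (ycoord z ^+ j * rad (xcoord z) (ycoord z)).
Definition flux_x z : R := `|u z| `^ p * field_x j b (xcoord z) (ycoord z).
Definition flux_y z : R := `|u z| `^ p * field_y j k b (xcoord z) (ycoord z).
Definition dflux_x z : R :=
  `|u z| `^ p * dfield_x j b (xcoord z) (ycoord z) +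
  field_x j b (xcoord z) (ycoord z) * (p * sgn_powR (p - 1) (u z) *
    partial ix u z).
Definition dflux_y z : R :=
  `|u z| `^ p * dfield_y j k b (xcoord z) (ycoord z) +
  field_y j k b (xcoord z) (ycoord z) * (p * sgn_powR (p - 1) (u z) *
    partial iy u z).

Let p0 : 0 < p. Proof. by have := p1; lra. Qed.
Let pn : p != 0. Proof. by rewrite gt_eqF. Qed.
Let q0 : 0 < p - 1. Proof. by have := p1; lra. Qed.
Let qn : p - 1 != 0. Proof. by rewrite gt_eqF. Qed.

Lemma support_ycoord_gt0 z : K z -> 0 < ycoord z.
Proof. by have [_ _ sub] := hu; move=> /sub; rewrite /halfspace/= mxE. Qed.

Lemma compact_support : compact K. Proof. by have [] := hu. Qed.

Lemma u_continuous : continuous u.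
Proof. by have [/(_ 0%N)[]] := hu. Qed.

Lemma u_derivable i z : derivable u z (delta_mx 0 i).
Proof. by have [/(_ 1%N)[_ /(_ i)[du _]] _ _] := hu; exact: du. Qed.

Lemma partial_continuous i : continuous (partial i u).
Proof. by have [/(_ 1%N)[_ /(_ i)[_ [cu _]]] _ _] := hu. Qed.

Lemma norm_powR_u0 z : u z = 0 -> `|u z| `^ p = 0.
Proof. by move=> ->; rewrite normr0 powR0. Qed.

Lemma sgn_powR_u0 z : u z = 0 -> sgn_powR (p - 1) (u z) = 0.
Proof. by move=> ->; rewrite sgn_powR_ge0// powR0. Qed.

Lemma gradient_term_off z : ~ K z -> gradient_term z = 0.
Proof.
move=> nK; rewrite /gradient_term /enorm big1 ?sqrtr0 ?powR0 ?mul0r// => i _.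
by rewrite mxE partial_support0// expr0n.
Qed.

Lemma hardy_term_off z : ~ K z -> hardy_term z = 0.
Proof. by move=> /closure_support0 uz;
  rewrite /hardy_term norm_powR_u0// mul0r. Qed.

Lemma remainder_term_off z : ~ K z -> remainder_term z = 0.
Proof. by move=> /closure_support0 uz;
  rewrite /remainder_term norm_powR_u0// mul0r. Qed.

Lemma flux_x_off z : u z = 0 -> flux_x z = 0.
Proof. by move=> uz; rewrite /flux_x norm_powR_u0// mul0r. Qed.

Lemma flux_y_off z : u z = 0 -> flux_y z = 0.
Proof. by move=> uz; rewrite /flux_y norm_powR_u0// mul0r. Qed.

Lemma dflux_x_off z : ~ K z -> dflux_x z = 0.
Proof.
by move=> /closure_support0 uz;
  rewrite /dflux_x norm_powR_u0// sgn_powR_u0// !(mul0r, mulr0) addr0.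
Qed.

Lemma dflux_y_off z : ~ K z -> dflux_y z = 0.
Proof.
by move=> /closure_support0 uz;
  rewrite /dflux_y norm_powR_u0// sgn_powR_u0// !(mul0r, mulr0) addr0.
Qed.

Lemma has_partial_flux_x : has_partial ix flux_x dflux_x.
Proof.
apply: (@has_partial_off _ _ u) => [z uz|z Kz|z nK].
- exact: flux_x_off.
- have y0 := support_ycoord_gt0 Kz.
  have hV := is_derive_translate
    (@is_derive_field_x R j b (xcoord z) _ y0 (ltn0Sn n)).
  have hu1 := derivable_has_partial (fun z => @u_derivable ix z) z.
  have e0 : u (z + (0 : R) *: delta_mx 0 ix) = u z by rewrite scale0r addr0.
  have hU : is_derive (0 : R) 1
      (fun h : R => `|u (z + h *: delta_mx 0 ix)| `^ p)
      (p * sgn_powR (p - 1) (u z) * partial ix u z).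
    apply: (@is_derive1_comp R (fun t : R => `|t| `^ p)
      (fun h : R => u (z + h *: delta_mx 0 ix))) => //.
    by rewrite e0; exact: is_derive_norm_powR.
  have := is_deriveM hU hV.
  have -> : (fun h : R => `|u (z + h *: delta_mx 0 ix)| `^ p) *
      (fun h : R => field_x j b (xcoord z + h) (ycoord z)) =
    (fun h : R => flux_x (z + h *: delta_mx 0 ix)).
    apply/funext => h; rewrite /flux_x/= fctE; congr (_ * field_x j b _ _).
      by rewrite /xcoord !mxE !eqxx mulr1.
    by rewrite /ycoord !mxE eq_rlshift andbF mulr0 addr0.
  move=> /is_derive_eq; apply.
  by rewrite e0 addr0.
- exact: dflux_x_off.
Qed.

Lemma has_partial_flux_y : has_partial iy flux_y dflux_y.
Proof.
apply: (@has_partial_off _ _ u) => [z uz|z Kz|z nK].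
- exact: flux_y_off.
- have y0 := support_ycoord_gt0 Kz.
  have hV := is_derive_translate
    (@is_derive_field_y R j k b (xcoord z) _ y0 (ltn0Sn n)).
  have hu1 := derivable_has_partial (fun z => @u_derivable iy z) z.
  have e0 : u (z + (0 : R) *: delta_mx 0 iy) = u z by rewrite scale0r addr0.
  have hU : is_derive (0 : R) 1
      (fun h : R => `|u (z + h *: delta_mx 0 iy)| `^ p)
      (p * sgn_powR (p - 1) (u z) * partial iy u z).
    apply: (@is_derive1_comp R (fun t : R => `|t| `^ p)
      (fun h : R => u (z + h *: delta_mx 0 iy))) => //.
    by rewrite e0; exact: is_derive_norm_powR.
  have := is_deriveM hU hV.
  have -> : (fun h : R => `|u (z + h *: delta_mx 0 iy)| `^ p) *
      (fun h : R => field_y j k b (xcoord z) (ycoord z + h)) =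
    (fun h : R => flux_y (z + h *: delta_mx 0 iy)).
    apply/funext => h; rewrite /flux_y/= fctE; congr (_ * field_y j k b _ _).
      by rewrite /xcoord !mxE eq_lrshift andbF mulr0 addr0.
    by rewrite /ycoord !mxE !eqxx mulr1.
  move=> /is_derive_eq; apply.
  by rewrite e0 addr0.
- exact: dflux_y_off.
Qed.

Section continuity.
Variable z : 'rV[R]_(n.+1 + 1).
Hypothesis Kz : K z.
Let y0 : 0 < ycoord z. Proof. exact: support_ycoord_gt0. Qed.

Let cy : ycoord w @[w --> z] --> ycoord z.
Proof. exact: coord_continuous. Qed.
Let cx : xcoord w @[w --> z] --> xcoord z.
Proof. exact: coord_continuous. Qed.
Let cyX (e : nat) : (ycoord w ^+ e)^-1 @[w --> z] --> (ycoord z ^+ e)^-1.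
Proof.
have yn : ycoord z ^+ e != 0 by rewrite expf_neq0// gt_eqF.
exact: cvgV yn (cvg_exprn cy).
Qed.
Let crad : rad (xcoord w) (ycoord w) @[w --> z] --> rad (xcoord z) (ycoord z).
Proof.
apply: (@cvg_comp _ _ _ (fun w => ycoord w ^+ 2 + xcoord w ^+ 2) (@Num.sqrt R));
  last exact: sqrt_continuous.
exact: cvgD (cvg_exprn cy) (cvg_exprn cx).
Qed.
Let cradV : (rad (xcoord w) (ycoord w))^-1 @[w --> z] -->
  (rad (xcoord z) (ycoord z))^-1.
Proof.
have rn : rad (xcoord z) (ycoord z) != 0 by rewrite gt_eqF ?rad_gt0.
exact: cvgV rn crad.
Qed.
Let csin : sine (xcoord w) (ycoord w) @[w --> z] --> sine (xcoord z) (ycoord z).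
Proof. exact: cvgM cy cradV. Qed.
Let ccos : cosine (xcoord w) (ycoord w) @[w --> z] -->
  cosine (xcoord z) (ycoord z).
Proof. exact: cvgM cx cradV. Qed.
Let cabs : `|u w| `^ p @[w --> z] --> `|u z| `^ p.
Proof.
apply: (@cvg_comp _ _ _ u (fun t : R => `|t| `^ p)); first exact: u_continuous.
exact: continuous_norm_powR.
Qed.
Let cspow : sgn_powR (p - 1) (u w) @[w --> z] --> sgn_powR (p - 1) (u z).
Proof.
apply: (@cvg_comp _ _ _ u (sgn_powR (p - 1))); first exact: u_continuous.
exact: continuous_sgn_powR.
Qed.
Let cpart i : partial i u w @[w --> z] --> partial i u z.
Proof. exact: partial_continuous. Qed.

Lemma gradient_term_continuous : {for z, continuous gradient_term}.
Proof.
have cgrad i : (gradient u w) 0 i @[w --> z] --> (gradient u z) 0 i.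
  have -> : (fun w => (gradient u w) 0 i) = partial i u.
    by apply/funext => w; rewrite mxE.
  by rewrite mxE; exact: cpart.
have csum : \sum_i (gradient u w) 0 i ^+ 2 @[w --> z] -->
    \sum_i (gradient u z) 0 i ^+ 2.
  exact: (@cvg_sum_ord R _ (nbhs z) _ _ (fun i w => (gradient u w) 0 i ^+ 2)
    (fun i => (gradient u z) 0 i ^+ 2) (fun i => cvg_exprn (cgrad i))).
have cen : enorm (gradient u w) @[w --> z] --> enorm (gradient u z).
  exact: (@cvg_comp _ _ _ (fun w => \sum_i (gradient u w) 0 i ^+ 2)
    (@Num.sqrt R)
    _ _ _ csum (@sqrt_continuous _ _)).
have c1 : enorm (gradient u w) `^ p @[w --> z] --> enorm (gradient u z) `^ p.
  have en0 w : 0 <= enorm (gradient u w) by exact: sqrtr_ge0.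
  have := cvg_norm_powR p0 cen; rewrite ger0_norm//.
  have -> // : (fun w => `|enorm (gradient u w)| `^ p) =
      (fun w => enorm (gradient u w) `^ p).
  by apply/funext => w; rewrite ger0_norm.
have yn : ycoord z `^ (j.+1%:R - p) != 0 by rewrite gt_eqF// powR_gt0.
have cp : {for ycoord z, continuous (fun t : R => t `^ (j.+1%:R - p))}.
  apply: differentiable_continuous; apply/derivable1_diffP.
  by have [] := is_derive1_powR (j.+1%:R - p) y0.
have c2 : ycoord w `^ (j.+1%:R - p) @[w --> z] --> ycoord z `^ (j.+1%:R - p).
  exact: (@cvg_comp _ _ _ ycoord (fun t : R => t `^ (j.+1%:R - p)) _ _ _ cy cp).
exact: cvgM c1 (cvgV yn c2).
Qed.

Lemma hardy_term_continuous : {for z, continuous hardy_term}.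
Proof. exact: (cvgM cabs (@cyX j.+1)). Qed.

Lemma remainder_term_continuous : {for z, continuous remainder_term}.
Proof.
have -> : remainder_term = (fun w => `|u w| `^ p *
    ((ycoord w ^+ j)^-1 * (rad (xcoord w) (ycoord w))^-1)).
  by apply/funext => w; rewrite /remainder_term invfM.
exact: (cvgM cabs (cvgM (@cyX j) cradV)).
Qed.

Local Notation sn w := (sine (xcoord w) (ycoord w)).
Let cs2 : sn w ^+ 2 @[w --> z] --> sn z ^+ 2.
Proof. exact: cvg_exprn csin. Qed.
Let cst_ (c : R) : c @[w --> z] --> c.
Proof. exact: (@cst_continuous _ _ c z). Qed.
Let cWx : field_x j b (xcoord w) (ycoord w) @[w --> z] -->
  field_x j b (xcoord z) (ycoord z).
Proof. exact: (cvgM (@cyX j) (cvgM (@cst_ (- (b / m))) (cvgM csin ccos))). Qed.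
Let cb : k * sn w + b * sn w ^+ 2 @[w --> z] -->
  k * sn z + b * sn z ^+ 2.
Proof. exact: (cvgD (cvgM (@cst_ k) csin) (cvgM (@cst_ b) cs2)). Qed.
Let cb2 : k * sn w + 2 * b * sn w ^+ 2 @[w --> z] -->
  k * sn z + 2 * b * sn z ^+ 2.
Proof. exact: (cvgD (cvgM (@cst_ k) csin) (cvgM (@cst_ (2 * b)) cs2)). Qed.
Let cc2 : 1 - sn w ^+ 2
    @[w --> z] --> 1 - sn z ^+ 2.
Proof. exact: (cvgB (@cst_ 1) cs2). Qed.
Let cWy : field_y j k b (xcoord w) (ycoord w) @[w --> z] -->
  field_y j k b (xcoord z) (ycoord z).
Proof.
have h : 1 - (k * sn w + b * sn w ^+ 2) / m @[w --> z] -->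
  1 - (k * sn z + b * sn z ^+ 2) / m.
  exact: (cvgB (@cst_ 1) (cvgM cb (@cst_ m^-1))).
exact: (cvgM (@cyX j) h).
Qed.
Let cyN : - (ycoord w ^+ j.+1)^-1 @[w --> z] --> - (ycoord z ^+ j.+1)^-1.
Proof. exact: cvgN (@cyX j.+1). Qed.
Let cdWx : dfield_x j b (xcoord w) (ycoord w) @[w --> z] -->
  dfield_x j b (xcoord z) (ycoord z).
Proof.
have h : 2 * sn w ^+ 2 - 1 @[w --> z] -->
    2 * sn z ^+ 2 - 1.
  exact: (cvgB (cvgM (@cst_ 2) cs2) (@cst_ 1)).
exact: (cvgM cyN (cvgM (@cst_ (b / m)) (cvgM cs2 h))).
Qed.
Let cdWy : dfield_y j k b (xcoord w) (ycoord w) @[w --> z] -->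
  dfield_y j k b (xcoord z) (ycoord z).
Proof.
have h : (k * sn w + 2 * b * sn w ^+ 2) *
    (1 - sn w ^+ 2) / m @[w --> z] -->
    (k * sn z + 2 * b * sn z ^+ 2) *
    (1 - sn z ^+ 2) / m.
  exact: (cvgM (cvgM cb2 cc2) (@cst_ m^-1)).
have h2 : m - (k * sn w + b * sn w ^+ 2) @[w --> z] -->
  m - (k * sn z + b * sn z ^+ 2).
  exact: (cvgB (@cst_ m) cb).
have h3 : m - (k * sn w + b * sn w ^+ 2) +
    (k * sn w + 2 * b * sn w ^+ 2) *
    (1 - sn w ^+ 2) / m @[w --> z] -->
  m - (k * sn z + b * sn z ^+ 2) +
    (k * sn z + 2 * b * sn z ^+ 2) *
    (1 - sn z ^+ 2) / m.
  exact: (cvgD h2 h).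
exact: (cvgM cyN h3).
Qed.

Lemma flux_x_continuous : {for z, continuous flux_x}.
Proof. exact: (cvgM cabs cWx). Qed.

Lemma flux_y_continuous : {for z, continuous flux_y}.
Proof. exact: (cvgM cabs cWy). Qed.

Lemma dflux_x_continuous : {for z, continuous dflux_x}.
Proof.
exact: (cvgD (cvgM cabs cdWx)
  (cvgM cWx (cvgM (cvgM (@cst_ p) cspow) (@cpart ix)))).
Qed.

Lemma dflux_y_continuous : {for z, continuous dflux_y}.
Proof.
exact: (cvgD (cvgM cabs cdWy)
  (cvgM cWy (cvgM (cvgM (@cst_ p) cspow) (@cpart iy)))).
Qed.

End continuity.

Lemma pointwise_hardy_at z :
  (m / p) `^ (p - 1) * (dflux_x z + dflux_y z) <=
  gradient_term z - (m / p) `^ p * hardy_term z - (m / p) `^ (p - 2) *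
    (k / p) * remainder_term z.
Proof.
have [Kz|nK] := pselect (K z); last first.
  rewrite gradient_term_off// hardy_term_off// remainder_term_off//.
  by rewrite dflux_x_off// dflux_y_off// addr0 !mulr0 !subr0.
have y0 := support_ycoord_gt0 Kz.
have G0 : 0 <= enorm (gradient u z) by exact: sqrtr_ge0.
have aG : partial ix u z ^+ 2 +
  partial iy u z ^+ 2 <= enorm (gradient u z) ^+ 2.
  rewrite sqr_sqrtr; last by apply: sumr_ge0 => i _; exact: sqr_ge0.
  have yx : iy != ix by rewrite eq_rlshift.
  rewrite (bigD1 ix)//= (bigD1 iy)//=.
  rewrite !mxE addrA lerDl.
  by apply: sumr_ge0 => i _; exact: sqr_ge0.
apply: le_trans (pointwise_hardy (xcoord z) (u z) p1 (ltn0Sn n) y0 G0 key aG).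
by rewrite /dflux_x /dflux_y le_eqVlt; apply/orP; left; apply/eqP; ring.
Qed.

Lemma hardy_inequality :
  (integral_halfspace (fun x y => gradient_term (row_mx x y%:M))
    - ((m / p) `^ p)%:E * integral_halfspace (fun x y =>
      hardy_term (row_mx x y%:M))
   >= ((m / p) `^ (p - 2) * (k / p))%:E *
     integral_halfspace (fun x y => remainder_term (row_mx x y%:M)))%E.
Proof.
have [M M0 KM] := compact_rV_bounded compact_support.
have ucF (F : 'rV[R]_(n.+1 + 1) -> R) : (forall z, K z ->
  {for z, continuous F}) ->
    (forall z, ~ K z -> F z = 0) -> uc_in_ball M F.
  move=> cF F0; apply: (continuous_uc_in_ball compact_support KM) => //.
  exact: (continuous_off compact_support).
have y_out z : z 0 iy <= 0 -> ~ K z.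
  by move=> y0 /support_ycoord_gt0; rewrite ltNge y0.
have U1 := ucF gradient_term gradient_term_continuous gradient_term_off.
have U2 := ucF hardy_term hardy_term_continuous hardy_term_off.
have U3 := ucF remainder_term remainder_term_continuous remainder_term_off.
have UDx := ucF dflux_x dflux_x_continuous dflux_x_off.
have UDy := ucF dflux_y dflux_y_continuous dflux_y_off.
have UPx := ucF flux_x flux_x_continuous
  (fun z nK => flux_x_off (closure_support0 nK)).
have UPy := ucF flux_y flux_y_continuous
  (fun z nK => flux_y_off (closure_support0 nK)).
rewrite (integral_halfspace_swap M0 U1 (fun z zy =>
  gradient_term_off (y_out z zy))).
rewrite (integral_halfspace_swap M0 U2 (fun z zy =>
  hardy_term_off (y_out z zy))).
rewrite (integral_halfspace_swap M0 U3 (fun z zy =>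
  remainder_term_off (y_out z zy))).
have JDx : @rintegral R (1 + j) (dflux_x \o @swap R j) = 0.
  exact: (rintegral_partial M0 (uc_in_ball_swap M0 UPx) (uc_in_ball_swap M0 UDx)
    (has_partial_swap_x has_partial_flux_x)).
have JDy : @rintegral R (1 + j) (dflux_y \o @swap R j) = 0.
  exact: (rintegral_partial M0 (uc_in_ball_swap M0 UPy) (uc_in_ball_swap M0 UDy)
    (has_partial_swap_y has_partial_flux_y)).
have := rintegral_ge M0 (uc_in_ball_swap M0 U1) (uc_in_ball_swap M0 U2)
  (uc_in_ball_swap M0 U3)
  (uc_in_ball_swap M0 UDx) (uc_in_ball_swap M0 UDy) JDx JDy (fun v =>
    pointwise_hardy_at (swap v)).
generalize (@rintegral R (1 + j) (gradient_term \o @swap R j))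
  (@rintegral R (1 + j) (hardy_term \o @swap R j))
  (@rintegral R (1 + j) (remainder_term \o @swap R j)) => a1 a2 a3 h.
by rewrite -!EFinM -EFinB lee_fin.
Qed.

End hardy.

Theorem theorem3p2 (R : realType) (p : R) (hp : 1 < p)
    (N : nat) (hN : (2 <= N)%N) :
  let p' : R := p / (p - 1) in
  let q : R := (N%:R - 1) / p in
  let Lambda : R := q `^ p in
  exists C : R,
    [/\ 0 < C,
        forall u : 'rV[R]_(N.-1 + 1) -> R,
          Cc_infty (@halfspace R N.-1) u ->
          (integral_halfspace (fun (x : 'rV[R]_(N.-1)) (y : R) =>
               enorm (gradient u (row_mx x y%:M)) `^ p / y `^ (N%:R - p))%R
           - Lambda%:E * integral_halfspace (fun (x : 'rV[R]_(N.-1)) (y : R) =>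
               `|u (row_mx x y%:M)| `^ p / y ^+ N)%R
           >= (q `^ (p - 2) * C)%:E
              * integral_halfspace (fun (x : 'rV[R]_(N.-1)) (y : R) =>
                  `|u (row_mx x y%:M)| `^ p
                  / (y ^+ N.-1 * Num.sqrt (y ^+ 2 + coord1 hN x ^+ 2)))%R)%E
      & [/\ p <= 4 / 3 -> C >= 1 / (4 * p'),
            4 / 3 < p <= 2 ->
              C >= (2 * (8 - 3 * p) + 2 * Num.sqrt (p' * (8 - 3 * p)))^-1,
            2 < p <= 2 * (N%:R - 1) ^+ 2 ->
              C = 1 / Num.sqrt 2 * (1 / (Num.sqrt 2 * p + 2 * Num.sqrt p))
          & p > 2 * (N%:R - 1) ^+ 2 ->
              C = (p / (N%:R - 1) + 2 * p + 2 * (N%:R - 1))^-1]].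
Proof.
case: N hN => [//|[//|n]] hN p' q Lambda.
have mE : n.+2%:R - 1 = n.+1%:R :> R by rewrite -[n.+2%:R]natr1 addrK.
have m1 : 1 <= n.+1%:R :> R by rewrite ler1n.
have p0 : 0 < p by lra.
have [k [b [k0 key constants]]] := key_parameters hp m1.
rewrite /Lambda /q mE; exists (k / p); split.
- by rewrite divr_gt0.
- move=> u hu; have := hardy_inequality hp hu key.
  have y_last x y : ycoord (row_mx x y%:M : 'rV[R]_(n.+1 + 1)) = y.
    by rewrite /ycoord row_mxEr mxE eqxx mulr1n.
  have x_first (x : 'rV[R]_n.+1) (y : R) :
      xcoord (row_mx x y%:M : 'rV[R]_(n.+1 + 1)) = coord1 hN x.
    by rewrite /xcoord row_mxEl /coord1; congr (x 0 _); exact: val_inj.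
  rewrite /gradient_term /hardy_term /remainder_term /rad.
  have E1 : (fun (x : 'rV[R]_n.+1) (y : R) =>
      enorm (gradient u (row_mx x y%:M)) `^ p /
      ycoord (row_mx x y%:M : 'rV[R]_(n.+1 + 1)) `^ (n.+2%:R - p)) =
    (fun x y => enorm (gradient u (row_mx x y%:M)) `^ p / y `^ (n.+2%:R - p)).
    by apply/funext => x; apply/funext => y; rewrite y_last.
  have E2 : (fun (x : 'rV[R]_n.+1) (y : R) => `|u (row_mx x y%:M)| `^ p /
      ycoord (row_mx x y%:M : 'rV[R]_(n.+1 + 1)) ^+ n.+2) =
    (fun x y => `|u (row_mx x y%:M)| `^ p / y ^+ n.+2).
    by apply/funext => x; apply/funext => y; rewrite y_last.
  have E3 : (fun (x : 'rV[R]_n.+1) (y : R) => `|u (row_mx x y%:M)| `^ p /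
      (ycoord (row_mx x y%:M : 'rV[R]_(n.+1 + 1)) ^+ n.+1 *
       Num.sqrt (ycoord (row_mx x y%:M : 'rV[R]_(n.+1 + 1)) ^+ 2 +
         xcoord (row_mx x y%:M : 'rV[R]_(n.+1 + 1)) ^+ 2))) =
    (fun x y => `|u (row_mx x y%:M)| `^ p / (y ^+ n.+1 *
       Num.sqrt (y ^+ 2 + coord1 hN x ^+ 2))).
    by apply/funext => x; apply/funext => y; rewrite y_last x_first.
  by rewrite E1 E2 E3.
- exact: constants.
Qed.
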